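(* Fix $q\in [0,1]$ and $n\geq 1$. Let $\{G_l\}_{l\in\mathbb{N}}$ be a $q$-Gaussian centered stationary family of random variables on some $W^*$-probability space $(\mathcal{A},\varphi)$, i.e., there exists $\rho:\mathbb{Z}\to\mathbb{R}$ such that for every integer $r\geq 1$ and every $l_1,\ldots,l_r\in\mathbb{N}$, \[ \varphi\big( G_{l_1}\cdots G_{l_r}\big)=\sum_{\pi \in \mathcal{P}_2(\{1,\ldots,r\})} q^{\mathrm{Cr}(\pi)} \prod_{\{a,b\}\in \pi} \rho(l_a-l_b). \] Assume $\rho(0)=1$ and $\sum_{l\in \mathbb{Z}} |\rho(l)|^n<\infty$. Then, as $k\to\infty$, \[ \left\{\frac{1}{\sqrt{k}} \sum_{l=0}^{[kt]} H_n^{(q)}(G_l)\right\}_{t\geq 0} \,\overset{\rm f.d.d.}{\longrightarrow}\, \sqrt{\sum_{\sigma\in \mathfrak{S}_n} q^{\mathrm{inv}(\sigma)} \sum_{l\in \mathbb{Z}} \rho(l)^n}\,\left\{X_t^{(q^{n^2})}\right\}_{t\geq 0}, \] where $X^{(q^{n^2})}$ is a $q^{n^2}$-Brownian motion.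
   Context: Convention $0^0=1$; $\mathbb{N}=\{0,1,2,\dots\}$. For $\sigma\in\mathfrak{S}_n$, $\mathrm{inv}(\sigma)=\mathrm{Card}\{1\le i<j\le n:\sigma(i)>\sigma(j)\}$. $\mathcal{P}_2(\{1,\dots,r\})$ is the set of pairings of $\{1,\dots,r\}$ (empty for $r$ odd); a crossing of $\pi$ is a pair of blocks $\{x_1,y_1\},\{x_2,y_2\}\in\pi$ with $x_1<x_2<y_1<y_2$, and $\mathrm{Cr}(\pi)$ is their number. A $W^*$-probability space $(\mathcal{A},\varphi)$ is a von Neumann algebra with a weakly continuous, positive, faithful, tracial unital linear functional $\varphi$; self-adjoint elements are random variables. For $q'\in(-1,1)$ a $q'$-Brownian motion is a family $\{X^{(q')}_t\}_{t\ge0}$ of random variables on such a space with $\varphi(X^{(q')}_{t_1}\cdots X^{(q')}_{t_r})=\sum_{\pi\in\mathcal{P}_2(\{1,\dots,r\})}q'^{\mathrm{Cr}(\pi)}\prod_{\{i,j\}\in\pi}(t_i\wedge t_j)$; for $q'=1$ it is a classical Brownian motion (and the $q$-Gaussian family with $q=1$ is a classical centered stationary Gaussian sequence with covariance $\rho$). The $q$-Hermite polynomials are defined by $H_0^{(q)}(x)=1$, $H_1^{(q)}(x)=x$, $xH_n^{(q)}(x)=H^{(q)}_{n+1}(x)+[n]_q H^{(q)}_{n-1}(x)$, where $[n]_q=\frac{1-q^n}{1-q}$ and $[n]_1=n$. ''f.d.d.'' convergence means that for all $t_1,\dots,t_d\ge0$ the finite families converge in law, i.e. all joint moments $\varphi(Y_k(s_1)\cdots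 Y_k(s_r))$, $s_j\in\{t_1,\dots,t_d\}$, converge to the corresponding joint moments of the limit process. *)

(* Defs.v *)
From HB Require Import structures.
From mathcomp Require Import all_boot all_order all_algebra.
From mathcomp Require Import fingroup perm.
From mathcomp Require Import complex.
From mathcomp Require Import all_classical all_reals.
From mathcomp Require Import topology normedtype sequences.
Set Implicit Arguments. Unset Strict Implicit. Unset Printing Implicit Defensive.
Import Order.TTheory GRing.Theory Num.Theory.
Import numFieldNormedType.Exports.
Local Open Scope ring_scope.
Local Open Scope complex_scope.

Section Defs.
Variable R : realType.
Local Notation C := R[i].

Definition is_Wstar_prob_space (A : algType C) (star : A -> A) (phi : A -> C) :=
  [/\ (forall x y : A, star (x + y) = star x + star y),
      (forall (a : C) (x : A), star (a *: x) = (conjc a) *: star x),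
      (forall x y : A, star (x * y) = star y * star x),
      (forall x : A, star (star x) = x) &
  [/\ (forall (a : C) (x y : A), phi (a *: x + y) = a * phi x + phi y),
      phi 1 = 1,
      (forall x : A, 0 <= phi (star x * x)),
      (forall x : A, phi (star x * x) = 0 -> x = 0) &
      (forall x y : A, phi (x * y) = phi (y * x))]].

(* A pairing of {1..r} is encoded (bijectively) by the fixed-point-free
   involution of 'I_r sending each point to its partner. *)
Definition is_pairing r (f : {ffun 'I_r -> 'I_r}) : bool :=
  [forall i, (f (f i) == i) && (f i != i)].

Definition crossings r (f : {ffun 'I_r -> 'I_r}) : nat :=
  #|[set ij : 'I_r * 'I_r |
       [&& (ij.1 < ij.2)%N, (ij.2 < f ij.1)%N & (f ij.1 < f ij.2)%N]]|.

Definition wick r (q : R) (cov : 'I_r -> 'I_r -> R) : R :=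
  \sum_(f : {ffun 'I_r -> 'I_r} | is_pairing f)
     q ^+ crossings f * \prod_(a : 'I_r | (a < f a)%N) cov a (f a).

Definition is_qGaussian_stationary (A : algType C) (phi : A -> C)
   (G : nat -> A) (q : R) (rho : int -> R) :=
  forall r : nat, (0 < r)%N -> forall l : 'I_r -> nat,
    phi (\prod_(i < r) G (l i)) =
      (wick q (fun a b => rho ((l a)%:Z - (l b)%:Z)))%:C.

Definition is_qBrownian_motion (A : algType C) (phi : A -> C)
   (X : R -> A) (q' : R) :=
  forall r : nat, forall t : 'I_r -> R, (forall i, 0 <= t i) ->
    phi (\prod_(i < r) X (t i)) =
      (wick q' (fun a b => Num.min (t a) (t b)))%:C.

Definition qint (q : R) (n : nat) : R :=
  if q == 1 then n%:R else (1 - q ^+ n) / (1 - q).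

(* qHermite_pair q n = (H_n, H_{n+1}) *)
Fixpoint qHermite_pair (q : R) (n : nat) : {poly R} * {poly R} :=
  match n with
  | 0 => (1, 'X)
  | m.+1 => let: (a, b) := qHermite_pair q m in
            (b, 'X * b - qint q m.+1 *: a)
  end.

Definition qHermite (q : R) (n : nat) : {poly R} := (qHermite_pair q n).1.

Definition peval (A : algType C) (p : {poly R}) (x : A) : A :=
  \sum_(i < size p) (p`_i)%:C *: x ^+ i.

Definition zpartial (f : int -> R) (N : nat) : R :=
  \sum_(0 <= i < N.*2.+1) f (i%:Z - N%:Z).

Definition abs_summable_Z (f : int -> R) : Prop :=
  exists M : R, forall N, zpartial (fun l => `|f l|) N <= M.

(* sum_{l in Z} f l (meaningful when f is absolutely summable) *)
Definition zsum (f : int -> R) : R := limn (zpartial f).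

Definition inv_count n (s : 'S_n) : nat :=
  #|[set ij : 'I_n * 'I_n | (ij.1 < ij.2)%N && (s ij.2 < s ij.1)%N]|.

Definition Yproc (A : algType C) (q : R) (n : nat) (G : nat -> A)
    (k : nat) (t : R) : A :=
  ((Num.sqrt (k%:R : R))^-1)%:C *:
    \sum_(0 <= l < (Num.truncn (k%:R * t)).+1) peval (qHermite q n) (G l).

Definition cvgC (u : nat -> C) (L : C) : Prop :=
  forall eps : R, 0 < eps -> exists N : nat, forall k : nat, (N <= k)%N ->
    `|u k - L| < eps%:C.

End Defs.

(* Main.v *)
(* Scanning a pairing from left to right with a stack of open points turns the
   q-Wick sum into a vacuum expectation on the q-Fock space, where closing the
   [i]-th open point costs [q ^+ i].  The q-Hermite recurrence then says that the
   moments of the [H_n (G_l)] are sums over the pairings of [r] blocks of [n]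
   points without pair inside a block.  Pairings that match the blocks two by two
   sum up to a q^(n^2)-Wick sum with covariance [[n]_q! rho^n]; each other pairing
   contributes a monomial in the covariances in which some block [v] sends
   strictly between [0] and [n] edges to some set [P] of blocks.  Summing out the
   indices of the blocks one at a time, with [v] just before [P], such a monomial
   is negligible because
   [sum_(|l| <= K) |rho l|^m = o(K^(1 - m/n))] for [0 < m < n]. *)
Require Import Defs.
From HB Require Import structures.
From mathcomp Require Import all_boot all_order all_algebra.
From mathcomp Require Import fingroup perm.
From mathcomp Require Import complex.
From mathcomp Require Import all_classical all_reals.
From mathcomp Require Import topology normedtype sequences exp.
From mathcomp Require Import ring lra zify.
Set Implicit Arguments. Unset Strict Implicit. Unset Printing Implicit Defensive.
Import Order.TTheory GRing.Theory Num.Theory.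
Import numFieldNormedType.Exports.
Local Open Scope ring_scope.

(** * q-Fock space *)

Section Fock.
Variables (R : comNzRingType) (T : Type) (q : R).
Implicit Types (cov : T -> T -> R) (x a : T) (K : seq T -> R) (s : seq T).

(** The normalisation is exactly critical. A monomial over [r] blocks has [n * r / 2] edges; each is
    charged to the endpoint that is summed out first, so in every elimination order the exponents
    [1 - m/n] add up to [r / 2], which the factor [k^(-r/2)] just cancels. Bounds of order O
    therefore give only boundedness, and one vertex must supply a little-o. The degrees [m = 0] and
    [m = n] supply none. A block joined to several others may show only these two degrees in a bad
    order (a 4-cycle with [n = 2], opposite vertices first): this is why irregularity speaks of a
    set [P], from which a good order is built. On the algebraic side, the coefficients of irregular
    pairings have no convenient form, and only their independence of the covariance matters. Regular
    and irregular pairings are thus told apart during the scan, the irregular ones being collected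
    in a list of monomials with unspecified coefficients. *)

Definition qsum n : R := \sum_(i < n) q ^+ i.
Definition qfact n : R := \prod_(i < n) qsum i.+1.

Lemma qsum0 : qsum 0 = 0. Proof. by rewrite /qsum big_ord0. Qed.

Lemma qsumS n : qsum n.+1 = 1 + q * qsum n.
Proof.
rewrite /qsum big_ord_recl expr0 mulr_sumr; congr (_ + _).
by apply: eq_bigr => i _; rewrite exprS.
Qed.

Lemma qfact0 : qfact 0 = 1. Proof. by rewrite /qfact big_ord0. Qed.

Lemma qfactS n : qfact n.+1 = qsum n.+1 * qfact n.
Proof. by rewrite /qfact big_ord_recr mulrC. Qed.

(** Operators act on functionals: [K] gives the value, on each stack, of what remains to be scanned,
    so that no vector of the Fock space has to be formed. *)
Fixpoint annih cov x K s : R :=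
  if s is a :: s' then cov a x * K s' + q * annih cov x (fun u => K (a :: u)) s'
  else 0.

Definition vac s : R := (nilp s)%:R.

Definition qfield cov x K s := K (x :: s) + annih cov x K s.

Definition fock cov w := foldr (qfield cov) vac w.

(* Scans the [n] remaining points of a block labelled [x] of which [m] points are
   already open; two points of the block are never paired together. *)
Fixpoint wickblock cov x n m K s : R :=
  if n is n'.+1
  then wickblock cov x n' m.+1 K s
       + q ^+ m * annih cov x (wickblock cov x n' m K) s
  else K (nseq m x ++ s).

Definition blockfock cov n w := foldr (fun x => wickblock cov x n 0) vac w.

Lemma eq_annih cov x K K' s : K =1 K' -> annih cov x K s = annih cov x K' s.
Proof.
by elim: s K K' => //= a s IH K K' e; rewrite e (IH _ (fun u => K' (a :: u))).
Qed.

Lemma annihD cov x K K' s :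
  annih cov x (fun u => K u + K' u) s = annih cov x K s + annih cov x K' s.
Proof.
elim: s K K' => [|a s IH] K K' /=; first by rewrite addr0.
by rewrite IH; ring.
Qed.

Lemma annihZ cov x c K s :
  annih cov x (fun u => c * K u) s = c * annih cov x K s.
Proof.
elim: s K => [|a s IH] K /=; first by rewrite mulr0.
by rewrite IH; ring.
Qed.

Lemma annih_cat cov x K s1 s2 :
  annih cov x K (s1 ++ s2) =
  annih cov x (fun u => K (u ++ s2)) s1
  + q ^+ size s1 * annih cov x (fun u => K (s1 ++ u)) s2.
Proof.
elim: s1 K => [|a s1 IH] K /=; first by rewrite add0r mul1r.
by rewrite IH exprS; ring.
Qed.

Lemma annih_nseq cov x K j a :
  annih cov x K (nseq j.+1 a) = qsum j.+1 * cov a x * K (nseq j a).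
Proof.
elim: j K => [|j IH] K; first by rewrite /= qsumS qsum0; ring.
have -> : annih cov x K (nseq j.+2 a) = cov a x * K (nseq j.+1 a)
   + q * annih cov x (fun u => K (a :: u)) (nseq j.+1 a) by [].
by rewrite IH [qsum j.+2]qsumS /=; ring.
Qed.

(** The entry [x] on top acts as one more open point unless a point of the block closes it. That
    closing jumps over the [m] open points, and every earlier one of the [n] points adds a factor
    [q]: if opened it lies above [x], if closed it has jumped over [x]. Summing over the closing
    point gives [qsum n]. For [n = 0] the value [n.-1] is harmless since [qsum 0 = 0]. *)
Lemma wickblock_cons cov x n m K s : cov x x = 1 ->
  wickblock cov x n m K (x :: s) =
  wickblock cov x n m.+1 K s
  + q ^+ m * qsum n * wickblock cov x n.-1 m K s.
Proof.
move=> cxx; elim: n m K s => [|n IH] m K s.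
  rewrite /= qsum0 mulr0 mul0r addr0; congr K.
  by elim: m => //= m ->.
have e : annih cov x (fun u => wickblock cov x n m K (x :: u)) s =
    annih cov x (wickblock cov x n m.+1 K) s
    + q ^+ m * qsum n * annih cov x (wickblock cov x n.-1 m K) s.
  by rewrite -annihZ -annihD; apply: eq_annih => u; rewrite IH.
rewrite [LHS]/= e IH cxx /=.
case: n IH e => [|n] IH e /=; first by rewrite !qsumS qsum0 exprS; ring.
by rewrite [qsum n.+2]qsumS !exprS; ring.
Qed.

(* [X N_n = N_(n+1) + [n] N_(n-1)]: the three-term recurrence of the
   q-Hermite polynomials. *)
Lemma qfield_wickblock cov x n K s : cov x x = 1 ->
  qfield cov x (wickblock cov x n 0 K) s =
  wickblock cov x n.+1 0 K s + qsum n * wickblock cov x n.-1 0 K s.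
Proof.
move=> cxx; rewrite /qfield wickblock_cons //=; ring.
Qed.

End Fock.

(** * Expansion of block scans into monomials of the covariance *)

Section Span.
Variables (R : comNzRingType) (T : eqType) (q : R) (n : nat).
Implicit Types (cov : T -> T -> R) (x a : T) (K : (T -> T -> R) -> seq T -> R).
Implicit Types (s w P S : seq T) (E : seq (T * T)) (Q : seq (T * T) -> Prop).
Implicit Types f g : (T -> T -> R) -> R.

Definition edgeprod cov E : R := \prod_(e <- E) cov e.1 e.2.

(** The list [L] comes before the quantifier over [cov]: one expansion serves all choices of the
    indices, hence all [k]. *)
Definition spanned Q f := exists L : seq (R * seq (T * T)),
  (forall p, p \in L -> Q p.2) /\
  forall cov, f cov = \sum_(p <- L) p.1 * edgeprod cov p.2.

Lemma eq_spanned Q f g : f =1 g -> spanned Q f -> spanned Q g.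
Proof. by move=> e [L [LQ h]]; exists L; split=> // cov; rewrite -e. Qed.

Lemma sub_spanned Q Q' f : (forall E, Q E -> Q' E) -> spanned Q f -> spanned Q' f.
Proof. by move=> QQ' [L [LQ h]]; exists L; split=> // p /LQ /QQ'. Qed.

Lemma spanned0 Q : spanned Q (fun=> 0).
Proof. by exists [::]; split=> // cov; rewrite big_nil. Qed.

Lemma spannedD Q f g : spanned Q f -> spanned Q g ->
  spanned Q (fun cov => f cov + g cov).
Proof.
move=> [L [LQ h]] [L' [LQ' h']]; exists (L ++ L'); split.
  by move=> p; rewrite mem_cat => /orP[/LQ|/LQ'].
by move=> cov; rewrite big_cat h h'.
Qed.

Lemma spannedZ Q (c : R) f : spanned Q f -> spanned Q (fun cov => c * f cov).
Proof.
move=> [L [LQ h]]; exists [seq (c * p.1, p.2) | p <- L]; split.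
  by move=> p /mapP[p' /LQ ? ->].
move=> cov; rewrite h big_map mulr_sumr.
by apply: eq_bigr => i _ /=; rewrite mulrA.
Qed.

Lemma spannedM Q Q' a x f : (forall E, Q E -> Q' ((a, x) :: E)) ->
  spanned Q f -> spanned Q' (fun cov => cov a x * f cov).
Proof.
move=> QQ' [L [LQ h]]; exists [seq (p.1, (a, x) :: p.2) | p <- L]; split.
  by move=> p /mapP[p' /LQ /QQ' ? ->].
move=> cov; rewrite h big_map mulr_sumr.
by apply: eq_bigr => i _ /=; rewrite /edgeprod big_cons; ring.
Qed.

Lemma spanned_annih Q x K s :
  (forall s1 a s2, s = s1 ++ a :: s2 ->
     spanned Q (fun cov => cov a x * K cov (s1 ++ s2))) ->
  spanned Q (fun cov => annih q cov x (K cov) s).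
Proof.
elim: s K => [|a s IH] K H /=; first exact: spanned0.
apply: spannedD; first exact: (H [::]).
apply: spannedZ; apply: (IH (fun cov u => K cov (a :: u))) => s1 b s2 es.
by apply: (H (a :: s1)); rewrite es.
Qed.

Definition degree E v := count (fun e => (e.1 == v) || (e.2 == v)) E.
Definition degree_to E v P :=
  count (fun e => (e.1 == v) && (e.2 \in P) || (e.2 == v) && (e.1 \in P)) E.

Definition disjoint_seq s w := forall v, v \in s -> v \notin w.

(* [E] is the list of pairs still to be formed when the stack is [s] and the
   blocks [w], of [n] points each, remain to be scanned. *)
Definition completes s w E :=
  [/\ all (fun e => (e.2 \in w) && (e.1 != e.2)) E,
      {in w, forall v, degree E v = n}
    & forall v, v \notin w -> degree E v = count_mem v s].

(** The same invariant inside the block [x], where [k] counts the points of [x] not yet paired, open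
    or unread. *)
Definition completes_at k s x w E :=
  [/\ all (fun e => (e.2 \in x :: w) && (e.1 != e.2)) E,
      {in w, forall v, degree E v = n}, degree E x = k
    & forall v, v \notin x :: w -> degree E v = count_mem v s].

(** [P] consists of unscanned blocks, so that the pairs formed earlier do not change
    [degree_to E v P]: a witness found late in the scan survives when these pairs are added. *)
Definition irregular w E :=
  exists v P, [/\ {subset P <= w}, v \notin P & (0 < degree_to E v P < n)%N].

Lemma completes_of_at s x w E : completes_at n s x w E -> completes s (x :: w) E.
Proof.
move=> [h1 h2 h3 h4]; split=> // v; rewrite inE => /orP[/eqP->//|]; exact: h2.
Qed.

Lemma completes_at0 m s x w E : x \notin w -> x \notin s ->
  completes (nseq m x ++ s) w E -> completes_at m s x w E.
Proof.
move=> xw xs [h1 h2 h3]; split=> //.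
- by apply: sub_all h1 => e /andP[ew ->]; rewrite inE ew orbT.
- by rewrite h3 // count_cat count_nseq /= eqxx mul1n (count_memPn xs) addn0.
move=> v; rewrite inE negb_or => /andP[vx vw].
by rewrite h3 // count_cat count_nseq /= eq_sym (negbTE vx).
Qed.

Lemma completes_at_cons k s1 a s2 x w E : x \notin w -> a \notin x :: w ->
  completes_at k (s1 ++ s2) x w E ->
  completes_at k.+1 (s1 ++ a :: s2) x w ((a, x) :: E).
Proof.
move=> xw axw [h1 h2 h3 h4].
have [ax aw] : a != x /\ a \notin w by move: axw; rewrite inE negb_or => /andP.
split=> //=.
- by rewrite h1 mem_head ax.
- move=> v vw; rewrite /degree /= -/(degree E v) h2 //.
  have -> : (a == v) = false by apply: contraNF aw => /eqP->.
  by have -> : (x == v) = false by apply: contraNF xw => /eqP->.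
- by rewrite /degree /= -/(degree E x) h3 eqxx orbT.
move=> v vxw; rewrite /degree /= -/(degree E v) h4 // !count_cat /=.
have -> : (x == v) = false by apply: contraNF vxw => /eqP->; rewrite mem_head.
by rewrite orbF addnCA.
Qed.

Lemma irregular_cons w a x E : x \notin w -> a \notin w ->
  irregular w E -> irregular w ((a, x) :: E).
Proof.
move=> xw aw [v [P [Pw vP d]]]; exists v, P; split=> //.
rewrite /degree_to /= -/(degree_to E v P).
have /negbTE-> : x \notin P by apply: contra xw => /Pw.
have /negbTE-> : a \notin P by apply: contra aw => /Pw.
by rewrite !andbF.
Qed.

(** The witness is [P = w]: every pair still to be formed ends in [w], so each open copy of [v]
    sends one edge there. *)
Lemma irregular_of_count s w E v : disjoint_seq s w -> completes s w E ->
  (0 < count_mem v s < n)%N -> irregular w E.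
Proof.
move=> dsw [h1 h2 h3] c; exists v, w.
have vw : v \notin w by apply: dsw; rewrite -has_pred1 has_count; case/andP: c.
split=> //; suff -> : degree_to E v w = count_mem v s by [].
rewrite -h3 //; apply: eq_in_count => e /(allP h1) /andP[ew _].
have /negbTE-> : e.2 != v by apply: contraNneq vw => <-.
by rewrite ew andbT /= !orbF.
Qed.

Lemma disjoint_seq_split s1 a s2 w : disjoint_seq (s1 ++ a :: s2) w ->
  disjoint_seq (s1 ++ s2) w /\ a \notin w.
Proof.
move=> d; split; last by apply: d; rewrite mem_cat mem_head orbT.
by move=> v vs; apply: d; move: vs; rewrite !mem_cat inE => /orP[]->; rewrite ?orbT.
Qed.

Lemma disjoint_seq_cons s x w :
  disjoint_seq s (x :: w) <-> disjoint_seq s w /\ x \notin s.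
Proof.
split=> [d|[d xs] v vs].
  split=> [v /d|]; first by rewrite inE negb_or => /andP[].
  by apply/negP => /d; rewrite mem_head.
by rewrite inE negb_or d // andbT; apply: contraNneq xs => <-.
Qed.

(** [B] carries a side property of the monomials and [D] the admissible numbers of points left open
    by the block; one induction then yields both the plain and the irregular expansion. *)
Lemma wickblock_spanned (B : seq (T * T) -> Prop) (D : nat -> Prop) K x w :
  x \notin w ->
  (forall a E, a \notin x :: w -> B E -> B ((a, x) :: E)) ->
  (forall m s, disjoint_seq s (x :: w) -> D m ->
     spanned (fun E => completes (nseq m x ++ s) w E /\ B E)
       (fun cov => K cov (nseq m x ++ s))) ->
  forall j m s, disjoint_seq s (x :: w) ->
  (forall m', (m <= m' <= m + j)%N -> D m') ->
  spanned (fun E => completes_at (m + j) s x w E /\ B E)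
    (fun cov => wickblock q cov x j m (K cov) s).
Proof.
move=> xw Bcons KB; elim=> [|j IH] m s ds Dm /=.
  have [_ xs] := (disjoint_seq_cons s x w).1 ds.
  rewrite addn0; apply: sub_spanned (KB _ _ ds _); last first.
    by apply: Dm; rewrite leqnn leq_addr.
  by move=> E [? ?]; split=> //; apply: completes_at0.
apply: spannedD.
  rewrite addnS -addSn; apply: IH => // m' /andP[h1 h2]; apply: Dm.
  by rewrite (ltnW h1) -addSnnS h2.
apply: spannedZ.
apply: (spanned_annih (K := fun cov => wickblock q cov x j m (K cov))).
move=> s1 a s2 es; move: ds; rewrite es => /disjoint_seq_split[ds axw].
apply: spannedM (IH m _ ds _); last first.
  move=> m' /andP[h1 h2]; apply: Dm; rewrite h1 addnS.
  exact: leq_trans h2 (leqnSn _).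
by move=> E [h1 h2]; split; [rewrite addnS; exact: completes_at_cons|exact: Bcons].
Qed.

Lemma blockfock_spanned s w : uniq w -> disjoint_seq s w ->
  spanned (completes s w) (fun cov => blockfock q cov n w s).
Proof.
elim: w s => [|x w IH] s /=.
  move=> _ _; case: s => [|a s]; last exact: (spanned0 _).
  exists [:: (1, [::])]; split; first by move=> p /[!inE] /eqP->; split.
  by move=> cov; rewrite big_seq1 /edgeprod big_nil mulr1.
move=> /andP[xw uw] ds.
apply: (@sub_spanned (fun E => completes_at (0 + n) s x w E /\ True)).
  by move=> E []; rewrite add0n => /completes_of_at.
apply: (@wickblock_spanned (fun=> True) (fun=> True)
  (fun cov => blockfock q cov n w)) => // m s' ds' _.
apply: (@sub_spanned (completes (nseq m x ++ s') w)) => //.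
apply: IH => // v; rewrite mem_cat => /orP[|/ds'].
  by rewrite mem_nseq => /andP[_ /eqP->].
by rewrite inE negb_or => /andP[].
Qed.

Lemma blockfock_irregular s w v : uniq w -> disjoint_seq s w ->
  (0 < count_mem v s < n)%N ->
  spanned (fun E => completes s w E /\ irregular w E)
    (fun cov => blockfock q cov n w s).
Proof.
move=> uw ds c; apply: sub_spanned (blockfock_spanned uw ds) => E cE.
by split=> //; apply: irregular_of_count c.
Qed.

Fixpoint closeblock cov x j (K : seq T -> R) s : R :=
  if j is j'.+1 then annih q cov x (closeblock cov x j' K) s else K s.

Definition blowup S := flatten [seq nseq n a | a <- S].

Section Block.
Variables (x : T) (w : seq T).
Hypotheses (xw : x \notin w) (uw : uniq w).
Let K cov := blockfock q cov n w.
Let spn k s f :=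
  spanned (fun E => completes_at k s x w E /\ irregular w E) f.

Let irr_cons a E : a \notin x :: w -> irregular w E -> irregular w ((a, x) :: E).
Proof. by rewrite inE negb_or => /andP[_ aw]; apply: irregular_cons. Qed.

Let spn_annih k s F :
  (forall s1 a s2, s = s1 ++ a :: s2 -> disjoint_seq (s1 ++ s2) (x :: w) ->
     spn k (s1 ++ s2) (fun cov => F cov (s1 ++ s2))) ->
  disjoint_seq s (x :: w) ->
  spn k.+1 s (fun cov => annih q cov x (F cov) s).
Proof.
move=> H ds; apply: spanned_annih => s1 a s2 es.
have := ds; rewrite es => /disjoint_seq_split[ds' axw].
apply: spannedM (H _ _ _ es ds') => E [? ?].
by split; [exact: completes_at_cons|exact: irr_cons].
Qed.

(** At least one point of the block is open and at least one is already closed, so between [1] and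
    [n - 1] copies of [x] end up on the stack. *)
Lemma wickblock_mixed j m s : disjoint_seq s (x :: w) -> (0 < m)%N ->
  (m + j < n)%N -> spn (m + j) s (fun cov => wickblock q cov x j m (K cov) s).
Proof.
move=> ds m0 mj.
apply: (@wickblock_spanned (irregular w) (fun m => 0 < m < n)%N) => //.
  move=> m' s' ds' m'n; apply: (@blockfock_irregular _ _ x) => //.
    move=> v; rewrite mem_cat => /orP[|/ds'].
      by rewrite mem_nseq => /andP[_ /eqP->].
    by rewrite inE negb_or => /andP[].
  have /disjoint_seq_cons[_ xs'] := ds'.
  by rewrite count_cat count_nseq /= eqxx mul1n (count_memPn xs') addn0.
by move=> m' /andP[h1 h2]; rewrite (leq_trans m0 h1) (leq_ltn_trans h2 mj).
Qed.

(** After a first opening, a single closing leads to [wickblock_mixed]; only the branch that opens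
    everything is left. [wickblock_close] is the dual statement. *)
Lemma wickblock_open j m s : disjoint_seq s (x :: w) -> (0 < m)%N ->
  (m + j = n)%N ->
  spn n s (fun cov => wickblock q cov x j m (K cov) s - K cov (nseq n x ++ s)).
Proof.
elim: j m => [|j IH] m ds m0 mj.
  rewrite addn0 in mj; subst m.
  by apply: eq_spanned (spanned0 _) => cov /=; rewrite subrr.
apply: (@eq_spanned _ (fun cov => wickblock q cov x j m.+1 (K cov) s -
   K cov (nseq n x ++ s)
   + q ^+ m * annih q cov x (wickblock q cov x j m (K cov)) s)).
  by move=> cov /=; ring.
apply: spannedD; first by apply: IH => //; rewrite addSnnS.
apply: spannedZ; rewrite -mj addnS.
apply: (@spn_annih _ _ (fun cov => wickblock q cov x j m (K cov))) => // s1 a s2 _ ds'.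
by apply: wickblock_mixed => //; rewrite -mj addnS.
Qed.

Lemma wickblock_close j s : disjoint_seq s (x :: w) -> (j < n)%N ->
  spn j s (fun cov => wickblock q cov x j 0 (K cov) s - closeblock cov x j (K cov) s).
Proof.
elim: j s => [|j IH] s ds jn.
  by apply: eq_spanned (spanned0 _) => cov /=; rewrite subrr.
apply: (@eq_spanned _ (fun cov => wickblock q cov x j 1 (K cov) s +
   annih q cov x (fun u => wickblock q cov x j 0 (K cov) u
        - closeblock cov x j (K cov) u) s)).
  move=> cov /=; rewrite mul1r -addrA; congr (_ + _).
  rewrite -[X in _ - X]mul1r -mulNr -annihZ -annihD; apply: eq_annih => u.
  by rewrite mulN1r.
apply: spannedD.
  by have := @wickblock_mixed j 1 s ds isT; rewrite add1n; apply.
apply: (@spn_annih _ _ (fun cov u => wickblock q cov x j 0 (K cov) u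
        - closeblock cov x j (K cov) u)) => // s1 a s2 _ ds'.
by apply: IH => //; exact: ltnW.
Qed.

Lemma wickblock_full s : (0 < n)%N -> disjoint_seq s (x :: w) ->
  spn n s (fun cov => wickblock q cov x n 0 (K cov) s
     - (K cov (nseq n x ++ s) + closeblock cov x n (K cov) s)).
Proof.
move=> n0 ds; have en : (n.-1.+1 = n)%N by rewrite prednK.
apply: (@eq_spanned _ (fun cov => (wickblock q cov x n.-1 1 (K cov) s
     - K cov (nseq n x ++ s)) +
   annih q cov x (fun u => wickblock q cov x n.-1 0 (K cov) u
        - closeblock cov x n.-1 (K cov) u) s)).
  move=> cov.
  have -> : wickblock q cov x n 0 (K cov) s
      = wickblock q cov x n.-1.+1 0 (K cov) s by rewrite en.
  have -> : closeblock cov x n (K cov) s = closeblock cov x n.-1.+1 (K cov) s.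
    by rewrite en.
  rewrite /= mul1r opprD addrACA; congr (_ + _).
  rewrite -[X in _ - X]mul1r -mulNr -annihZ -annihD; apply: eq_annih => u.
  by rewrite mulN1r.
apply: spannedD; first by apply: wickblock_open => //; rewrite add1n.
have := @spn_annih n.-1 s (fun cov u => wickblock q cov x n.-1 0 (K cov) u
        - closeblock cov x n.-1 (K cov) u); rewrite en; apply=> // s1 a s2 _ ds'.
by apply: wickblock_close => //; rewrite en.
Qed.

(** The [j] closings cannot exhaust more than [j] copies of [v], so this group leaves the block
    neither empty nor full. *)
Lemma closeblock_irregular j s v : disjoint_seq s (x :: w) ->
  (j < count_mem v s < n)%N -> spn j s (fun cov => closeblock cov x j (K cov) s).
Proof.
elim: j s => [|j IH] s ds c /=.
  have /disjoint_seq_cons[dsw xs] := ds.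
  apply: sub_spanned (blockfock_irregular uw dsw c) => E [h1 h2].
  by split=> //; apply: completes_at0.
apply: (@spn_annih _ _ (fun cov => closeblock cov x j (K cov))) => // s1 a s2 es ds'.
apply: IH => //; move: c; rewrite es !count_cat /=.
by case: (a == v) => /=; lia.
Qed.

Lemma blowup_cat S1 S2 : blowup (S1 ++ S2) = blowup S1 ++ blowup S2.
Proof. by rewrite /blowup map_cat flatten_cat. Qed.

Lemma mem_blowup S v : v \in blowup S -> v \in S.
Proof. by case/flatten_mapP=> a aS; rewrite mem_nseq => /andP[_ /eqP->]. Qed.

Lemma count_blowup S v : uniq S -> v \in S -> count_mem v (blowup S) = n.
Proof.
elim: S => //= a S IH /andP[aS uS]; rewrite inE.
rewrite /blowup /= -/(blowup S) count_cat count_nseq /= [v == a]eq_sym.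
case: eqVneq => [<- _|_ /= vS]; last by rewrite mul0n add0n IH.
rewrite mul1n (count_memPn _) ?addn0 //.
by apply: contra aS => /mem_blowup.
Qed.

Lemma size_blowup S : size (blowup S) = (n * size S)%N.
Proof.
by elim: S => [|a S IH]; rewrite ?muln0 // /blowup /= size_cat size_nseq
   -/(blowup S) IH mulnS.
Qed.

(* After one point of the group of [b <> a] has been closed, at most [n.-2] more
   can be, so this group ends up neither full nor empty. *)
Lemma closeblock_other S1 j a S2 b s1 s2 :
  uniq (S1 ++ a :: S2) -> (j.+1 < n)%N -> b \in S1 ++ S2 ->
  blowup S1 ++ nseq j.+1 a ++ blowup S2 = s1 ++ b :: s2 ->
  disjoint_seq (s1 ++ s2) (x :: w) ->
  spn j (s1 ++ s2) (fun cov => closeblock cov x j (K cov) (s1 ++ s2)).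
Proof.
move=> u jn bS es ds; apply: (closeblock_irregular ds (v := b)).
have := congr1 (count_mem b) es; rewrite !count_cat /= eqxx add1n addnS.
have [aS uS] : a \notin S1 ++ S2 /\ uniq (S1 ++ S2).
  by move: u; rewrite -cat1s uniq_catCA cat1s /= => /andP.
have ba : (a == b) = false by apply: contraNF aS => /eqP->.
rewrite count_nseq /= ba mul0n add0n => e.
have := count_blowup uS bS; rewrite blowup_cat count_cat; lia.
Qed.

(** All closings must hit the group of [a]. Each jumps over the [n * size S1] points above it, and
    the choices among the equal copies of [a] sum up to [qfact q j]. *)
Lemma closeblock_group S1 a S2 j :
  uniq (S1 ++ a :: S2) -> (j < n)%N ->
  disjoint_seq (blowup S1 ++ nseq j a ++ blowup S2) (x :: w) ->
  spn j (blowup S1 ++ nseq j a ++ blowup S2) (fun cov =>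
    closeblock cov x j (K cov) (blowup S1 ++ nseq j a ++ blowup S2)
    - q ^+ (n * size S1 * j) * qfact q j * cov a x ^+ j
      * K cov (blowup S1 ++ blowup S2)).
Proof.
elim: j => [|j IH] u jn ds.
  apply: eq_spanned (spanned0 _) => cov /=.
  by rewrite muln0 qfact0 !expr0 !mul1r subrr.
set b1 := blowup S1 in IH ds *; set b2 := blowup S2 in IH ds *.
set s := b1 ++ _ in ds *.
pose C cov := closeblock cov x j (K cov).
have other s1 b s2 : b \in S1 ++ S2 -> s = s1 ++ b :: s2 ->
    spn j.+1 s (fun cov => cov b x * C cov (s1 ++ s2)).
  move=> bS es; have := ds; rewrite es => /disjoint_seq_split[ds' bxw].
  have := @closeblock_other S1 j a S2 b s1 s2 u jn bS es ds'.
  apply: spannedM => E [? ?].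
  by split; [exact: completes_at_cons|exact: irr_cons].
have ds' : disjoint_seq (b1 ++ nseq j a ++ b2) (x :: w).
  by have /disjoint_seq_split[] := ds.
have axw : a \notin x :: w by have /disjoint_seq_split[] := ds.
(* The first closing falls in [S1], in the group of [a], or in [S2]; by [other] the two outer cases
   are irregular. *)
apply: (@eq_spanned _ (fun cov =>
   annih q cov x (fun u => C cov (u ++ nseq j.+1 a ++ b2)) b1
   + q ^+ size b1 * (qsum q j.+1 * (cov a x * (C cov (b1 ++ nseq j a ++ b2)
     - q ^+ (n * size S1 * j) * qfact q j * cov a x ^+ j * K cov (b1 ++ b2)))
   + q ^+ j.+1 * annih q cov x (fun u => C cov (b1 ++ nseq j.+1 a ++ u)) b2))).
  move=> cov; rewrite [closeblock _ _ _ _ _]/= -/(C cov) !annih_cat annih_nseq.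
  rewrite size_nseq size_blowup qfactS !exprS mulnS exprD.
  by set y1 := annih _ _ _ _ b1; set y2 := annih _ _ _ _ b2; ring.
apply: spannedD.
  apply: (spanned_annih (K := fun cov u => C cov (u ++ nseq j.+1 a ++ b2))).
  move=> s1 b s2 es.
  apply: (@eq_spanned _ (fun cov => cov b x * C cov (s1 ++ (s2 ++ nseq j.+1 a ++ b2)))).
    by move=> cov; rewrite catA.
  apply: other; last by rewrite /s es -catA.
  by rewrite mem_cat mem_blowup // -/b1 es mem_cat mem_head orbT.
apply: spannedZ; apply: spannedD.
  apply: spannedZ; apply: spannedM (IH u (ltnW jn) ds') => E [h1 h2].
  by split; [exact: completes_at_cons|exact: irr_cons].
apply: spannedZ.
apply: (spanned_annih (K := fun cov u => C cov (b1 ++ nseq j.+1 a ++ u))).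
move=> s1 b s2 es.
apply: (@eq_spanned _ (fun cov => cov b x * C cov ((b1 ++ nseq j.+1 a ++ s1) ++ s2))).
  by move=> cov; rewrite -!catA.
apply: other; last by rewrite /s es -!catA.
by rewrite mem_cat (@mem_blowup S2) ?orbT // -/b2 es mem_cat mem_head orbT.
Qed.

Let cov' cov a b : R := qfact q n * cov a b ^+ n.

(** The first closing selects a group and the other [n.-1] must follow it. The induction moves
    skipped groups from [S2] to [S1]. Skipping a group costs [q ^+ n] for the first closing and
    [q ^+ (n * n.-1)] for the others, together [q ^+ (n ^ 2)]. Here the first closing starts below
    [S1], so that [S1] is charged for the others only. *)
Lemma closeblock_blowup S1 S2 (K' : (T -> T -> R) -> seq T -> R) :
  (0 < n)%N -> uniq (S1 ++ S2) ->
  disjoint_seq (S1 ++ S2) (x :: w) ->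
  (forall S, uniq S -> disjoint_seq S w ->
     spanned (fun E => completes (blowup S) w E /\ irregular w E)
       (fun cov => K cov (blowup S) - K' cov S)) ->
  spn n (blowup (S1 ++ S2)) (fun cov =>
    annih q cov x (fun u => closeblock cov x n.-1 (K cov) (blowup S1 ++ u))
      (blowup S2)
    - (q ^+ (n * n.-1)) ^+ size S1
      * annih (q ^+ (n ^ 2)) (cov' cov) x (fun u => K' cov (S1 ++ u)) S2).
Proof.
move=> n0 + + KK'; elim: S2 S1 => [|a S2 IH] S1 u ds.
  by apply: eq_spanned (spanned0 _) => cov /=; rewrite mulr0 subr0.
have en : n = n.-1.+1 by rewrite prednK.
have [aS uS] : a \notin S1 ++ S2 /\ uniq (S1 ++ S2).
  by move: u; rewrite -cat1s uniq_catCA cat1s /= => /andP.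
have [dsS axw] := disjoint_seq_split ds.
have eb : blowup (S1 ++ a :: S2) = blowup S1 ++ a :: nseq n.-1 a ++ blowup S2.
  by rewrite blowup_cat /blowup /= [X in nseq X a]en.
have dsb S : disjoint_seq S (x :: w) -> disjoint_seq (blowup S) (x :: w).
  by move=> dS v /mem_blowup /dS.
have ds1 : disjoint_seq (blowup S1 ++ nseq n.-1 a ++ blowup S2) (x :: w).
  by have := dsb _ ds; rewrite eb => /disjoint_seq_split[].
set c1 := q ^+ (n * n.-1).
pose C cov := closeblock cov x n.-1 (K cov).
pose D cov := C cov (blowup S1 ++ nseq n.-1 a ++ blowup S2)
   - q ^+ (n * size S1 * n.-1) * qfact q n.-1 * cov a x ^+ n.-1
      * K cov (blowup S1 ++ blowup S2).
pose F cov := annih q cov x (fun u => C cov (blowup (rcons S1 a) ++ u)) (blowup S2)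
  - c1 ^+ (size (rcons S1 a)) *
    annih (q ^+ (n ^ 2)) (cov' cov) x (fun u => K' cov (rcons S1 a ++ u)) S2.
(* The three errors: closings that start in the group of [a] but do not empty it, the replacement of
   [K] by [K'] once it is emptied, and the case where [a] is skipped. *)
apply: (@eq_spanned _ (fun cov =>
   qsum q n * (cov a x * D cov)
   + c1 ^+ size S1 * (qfact q n * (cov a x ^+ n *
      (K cov (blowup (S1 ++ S2)) - K' cov (S1 ++ S2))))
   + q ^+ n * F cov)).
  move=> cov; rewrite /F.
  have -> : annih q cov x (fun u => C cov (blowup (rcons S1 a) ++ u)) (blowup S2)
     = annih q cov x (fun u => C cov (blowup S1 ++ nseq n a ++ u)) (blowup S2).
    by apply: eq_annih => v; rewrite -cats1 blowup_cat /blowup /= cats0 -catA.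
  have -> : annih (q ^+ (n ^ 2)) (cov' cov) x (fun u => K' cov (rcons S1 a ++ u)) S2
     = annih (q ^+ (n ^ 2)) (cov' cov) x (fun u => K' cov (S1 ++ a :: u)) S2.
    by apply: eq_annih => v; rewrite cat_rcons.
  rewrite -/(C cov) [X in _ = _ - _ * X]/=.
  rewrite -[cov' cov a x]/(qfact q n * cov a x ^+ n).
  have -> : blowup (a :: S2) = nseq n a ++ blowup S2 by [].
  have ean G : annih q cov x G (nseq n a) = qsum q n * cov a x * G (nseq n.-1 a).
    by case: (n) n0 => // j _; rewrite annih_nseq.
  rewrite annih_cat size_nseq ean size_rcons /D blowup_cat.
  have -> : q ^+ (n ^ 2) = q ^+ n * c1.
    by rewrite /c1 -exprD -mulnS prednK.
  have -> : qfact q n = qsum q n * qfact q n.-1 by case: (n) n0 => // j _; rewrite qfactS.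
  have -> : cov a x ^+ n = cov a x * cov a x ^+ n.-1 by case: (n) n0 => // j _; rewrite exprS.
  have -> : q ^+ (n * size S1 * n.-1) = c1 ^+ size S1.
    by rewrite -exprM; congr (_ ^+ _); lia.
  by rewrite exprS; ring.
have consP k s1 s2 f : spn k (s1 ++ s2) f ->
    spn k.+1 (s1 ++ a :: s2) (fun cov => cov a x * f cov).
  apply: spannedM => E [h1 h2].
  by split; [exact: completes_at_cons|exact: irr_cons].
apply: spannedD; first apply: spannedD.
- apply: spannedZ; have := consP n.-1 _ _ D; rewrite eb -en; apply.
  by apply: closeblock_group => //; rewrite {2}en.
- do 2!apply: spannedZ; have /disjoint_seq_cons[dw xS] := dsS.
  (* The [n] pairs joining [a] to [x] are put back one at a time, each restoring a copy of [a] on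
     the stack. *)
  suff H j : spn j (blowup S1 ++ nseq j a ++ blowup S2) (fun cov =>
      cov a x ^+ j * (K cov (blowup (S1 ++ S2)) - K' cov (S1 ++ S2))).
    by have := H n; rewrite [blowup (S1 ++ a :: S2)]blowup_cat.
  elim: j => [|j IHj].
    apply: (@eq_spanned _ (fun cov => K cov (blowup (S1 ++ S2)) - K' cov (S1 ++ S2))).
      by move=> cov; rewrite mul1r.
    apply: sub_spanned (KK' _ uS dw) => E [h1 h2]; split=> //.
    apply: completes_at0 => //; last by rewrite -blowup_cat.
    by rewrite -blowup_cat; apply: contra xS => /mem_blowup.
  have := consP j _ _ _ IHj; apply: eq_spanned => cov.
  by rewrite exprS mulrA.
apply: spannedZ; have := IH (rcons S1 a); rewrite cat_rcons; exact.
Qed.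

End Block.

(** Modulo irregular monomials a block behaves like a single point: it opens entirely or closes one
    whole group, which are the two terms of [qfield]. *)
Theorem blockfock_regular w S : (0 < n)%N -> uniq w -> uniq S ->
  disjoint_seq S w ->
  spanned (fun E => completes (blowup S) w E /\ irregular w E)
    (fun cov => blockfock q cov n w (blowup S)
      - fock (q ^+ (n ^ 2)) (fun a b => qfact q n * cov a b ^+ n) w S).
Proof.
move=> n0; elim: w S => [|x w IH] S /=.
  move=> _ _ _; apply: eq_spanned (spanned0 _) => cov /=.
  case: S => [|a S]; first by rewrite subrr.
  by rewrite /blowup /= /vac; case: (n) n0 => //= j _; rewrite subrr.
move=> /andP[xw uw] uS dS; have /disjoint_seq_cons[dw xS] := dS.
pose K cov := blockfock q cov n w.
pose K' cov := fock (q ^+ (n ^ 2)) (fun a b => qfact q n * cov a b ^+ n) w.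
have KK' S' : uniq S' -> disjoint_seq S' w ->
     spanned (fun E => completes (blowup S') w E /\ irregular w E)
       (fun cov => K cov (blowup S') - K' cov S') by exact: IH.
have db : disjoint_seq (blowup S) (x :: w) by move=> v /mem_blowup /dS.
apply: (@eq_spanned _ (fun cov =>
   (wickblock q cov x n 0 (K cov) (blowup S)
     - (K cov (nseq n x ++ blowup S) + closeblock cov x n (K cov) (blowup S)))
   + (K cov (blowup (x :: S)) - K' cov (x :: S))
   + (closeblock cov x n (K cov) (blowup S)
     - annih (q ^+ (n ^ 2)) (fun a b => qfact q n * cov a b ^+ n) x (K' cov) S))).
  move=> cov; rewrite /qfield -/(K cov) -/(K' cov).
  have -> : blowup (x :: S) = nseq n x ++ blowup S by [].
  by ring.
have sub_irr E : irregular w E -> irregular (x :: w) E.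
  move=> [v [P [Pw vP d]]]; exists v, P; split=> // y /Pw.
  by rewrite inE orbC => ->.
have at_n (E : seq (T * T)) : completes_at n (blowup S) x w E /\ irregular w E ->
    completes (blowup S) (x :: w) E /\ irregular (x :: w) E.
  by move=> [h1 h2]; split; [exact: completes_of_at|exact: sub_irr].
apply: spannedD; first apply: spannedD.
- by apply: sub_spanned (wickblock_full xw uw n0 db).
- apply: sub_spanned (KK' (x :: S) _ _).
  + move=> E [h1 h2]; apply: at_n; split=> //; apply: completes_at0 => //.
    by apply: contra xS => /mem_blowup.
  + by rewrite /= xS.
  by move=> v; rewrite inE => /orP[/eqP->//|/dw].
apply: sub_spanned at_n _.
have := closeblock_blowup xw uw (S1 := [::]) (S2 := S) n0 uS dS KK'.
apply: eq_spanned => cov /=; rewrite expr0 mul1r; congr (_ - _).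
have clS j : (0 < j)%N -> closeblock cov x j (K cov) (blowup S)
    = annih q cov x (closeblock cov x j.-1 (K cov)) (blowup S) by case: j.
by rewrite clS.
Qed.

End Span.

(** * Wick sums as vacuum expectations *)

Lemma crossings_sum r (f : {ffun 'I_r -> 'I_r}) :
  crossings f = (\sum_(i < r) \sum_(j < r) [&& i < j, j < f i & f i < f j])%N.
Proof.
rewrite /crossings cardsE -sum1_card pair_big /= big_mkcond /=.
by apply: eq_bigr => -[i j] _ /=; rewrite unfold_in /=; case: ifP.
Qed.

(** The first [s] points form the stack: all of them still wait for a later partner. *)
Definition separated k (s : nat) (f : {ffun 'I_k -> 'I_k}) :=
  [forall x : 'I_k, (x < s)%N ==> (s <= f x)%N].

Lemma sum_ord_range r m p :
  (\sum_(z < r) (m <= z < p) = minn r p - m)%N.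
Proof. by elim: r => [|r IH]; rewrite ?big_ord0 ?big_ord_recr /= ?IH; lia. Qed.

(** * Inserting a pair into a pairing *)

Section RemovePair.
Variables (r : nat) (b : 'I_r.+2) (a' : 'I_r.+1).
Hypothesis ab : (a' < b)%N.
Let a : 'I_r.+2 := lift b a'.
Definition skip2 (z : 'I_r) : 'I_r.+2 := lift b (lift a' z).
Let h := skip2.

Let val_a : a = a' :> nat.
Proof. by rewrite /a /= /bump leqNgt ab. Qed.

Let cases3 (P : 'I_r.+2 -> Prop) : P a -> P b -> (forall z, P (h z)) -> forall x, P x.
Proof.
move=> Pa Pb Ph x; case: (unliftP b x) => [y ->|->//].
by case: (unliftP a' y) => [z ->|->//]; apply: Ph.
Qed.

Definition insert_pair (f : {ffun 'I_r -> 'I_r}) : {ffun 'I_r.+2 -> 'I_r.+2} :=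
  [ffun x => if unlift b x is Some y then
               if unlift a' y is Some z then h (f z) else b else a].

(** The fallback value [z] would require [h z] to be paired with [a] or [b], which is impossible for
    a pairing with [f b = a]. *)
Definition delete_pair (f : {ffun 'I_r.+2 -> 'I_r.+2}) : {ffun 'I_r -> 'I_r} :=
  [ffun z => if unlift b (f (h z)) is Some y then
               if unlift a' y is Some z' then z' else z else z].

Let ext_b f : insert_pair f b = a.
Proof. by rewrite ffunE unlift_none. Qed.
Let ext_a f : insert_pair f a = b.
Proof. by rewrite ffunE liftK unlift_none. Qed.
Let ext_h f z : insert_pair f (h z) = h (f z).
Proof. by rewrite ffunE /h /skip2 !liftK. Qed.

Let hinj : injective h.
Proof. by move=> z z' /lift_inj /lift_inj. Qed.
Let h_neq_b z : (h z == b) = false.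
Proof. by rewrite eq_sym (negbTE (neq_lift _ _)). Qed.
Let h_neq_a z : (h z == a) = false.
Proof. by rewrite (inj_eq lift_inj) eq_sym (negbTE (neq_lift _ _)). Qed.

Let val_h z : h z = bump b (bump a' z) :> nat. Proof. by []. Qed.

Let h_lt z z' : (h z < h z')%N = (z < z')%N.
Proof. by rewrite !val_h /bump; lia. Qed.
Let h_lt_b z : (h z < b)%N = (z < b.-1)%N.
Proof. by rewrite !val_h /bump; lia. Qed.
Let h_ge_b z : (b <= h z)%N = (b.-1 <= z)%N.
Proof. by rewrite !val_h /bump; lia. Qed.

Lemma delete_pairK f : is_pairing f -> f b = a -> insert_pair (delete_pair f) = f.
Proof.
move=> /forallP pf fb; have ff x : f (f x) = x by have /andP[/eqP] := pf x.
apply/ffunP; apply: cases3.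
- by rewrite ext_a -fb ff.
- by rewrite ext_b fb.
move=> z; rewrite ext_h ffunE.
case: (unliftP b (f (h z))) => [y ey|ey]; last first.
  by have := h_neq_a z; rewrite -fb -ey ff eqxx.
case: (unliftP a' y) ey => [z' ->//|->] ey.
by have := h_neq_b z; rewrite -(ff (h z)) ey -[lift b a']/a -fb ff eqxx.
Qed.

Lemma insert_pairK f : delete_pair (insert_pair f) = f.
Proof. by apply/ffunP => z; rewrite ffunE ext_h /h /skip2 !liftK. Qed.

Lemma insert_pair_pairing f : is_pairing (insert_pair f) = is_pairing f.
Proof.
apply/forallP/forallP => pf.
  by move=> z; have := pf (h z); rewrite !ext_h !(inj_eq hinj).
apply: cases3.
- by rewrite ext_a ext_b eqxx /= neq_lift.
- by rewrite ext_b ext_a eqxx /= eq_sym neq_lift.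
by move=> z; rewrite !ext_h !(inj_eq hinj).
Qed.

Lemma insert_pair_separated f :
  separated b (insert_pair f) = separated b.-1 f.
Proof.
apply/forallP/forallP => sf.
  by move=> z; have := sf (h z); rewrite ext_h h_lt_b h_ge_b.
apply: cases3.
- by rewrite ext_a leqnn implybT.
- by rewrite ltnn.
by move=> z; rewrite ext_h h_lt_b h_ge_b.
Qed.

Let big3 (S : Type) (idx : S) (op : Monoid.com_law idx) (F : 'I_r.+2 -> S) :
  \big[op/idx]_x F x = op (F b) (op (F a) (\big[op/idx]_z F (h z))).
Proof. by rewrite (bigD1_ord b) // (bigD1_ord a'). Qed.

(** All points before [b] other than [a] have their partner after [b]. Those before [a] start a pair
    that encloses the new one; each of the [b.-1 - a'] points between [a] and [b] starts a pair that
    crosses it. *)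
Lemma crossings_insert_pair f : separated b.-1 f ->
  crossings (insert_pair f) = (b.-1 - a' + crossings f)%N.
Proof.
move=> sf; have sfz (z : 'I_r) : (z < b.-1)%N -> (b.-1 <= f z)%N.
  by move=> zb; have /forallP/(_ z) := sf; rewrite zb.
rewrite !crossings_sum big3 /= big1 ?add0n => [|y _]; last first.
  by rewrite ext_b val_a; lia.
congr (_ + _)%N.
  rewrite big3 /= ext_a !ltnn /= andbF !add0n.
  under eq_bigr => z _.
    have -> : [&& (a < h z)%N, (h z < b)%N & (b < insert_pair f (h z))%N]
        = (a' <= z < b.-1)%N.
      rewrite ext_h val_a h_lt_b; case: (ltnP z b.-1) => zb; last by rewrite /= !andbF.
      have := sfz _ zb; rewrite !val_h /bump; lia.
    over.
  rewrite sum_ord_range; have := ltn_ord b; lia.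
apply: eq_bigr => z _; rewrite big3 /= ext_b ext_a !ext_h.
under eq_bigr do rewrite ext_h !h_lt.
have e z1 : (h z1 < b)%N = ~~ (b <= h z1)%N by rewrite ltnNge.
have -> : [&& (h z < b)%N, (b < h (f z))%N & (h (f z) < a)%N] = false.
  by rewrite val_a; lia.
have -> : [&& (h z < a)%N, (a < h (f z))%N & (h (f z) < b)%N] = false; last by [].
rewrite val_a h_lt_b; have := sfz z; rewrite val_h /bump; lia.
Qed.

Lemma prod_insert_pair (R : comNzRingType) (c : nat -> nat -> R) f :
  \prod_(x : 'I_r.+2 | (x < insert_pair f x)%N) c x (insert_pair f x) =
  c a' b * \prod_(z : 'I_r | (z < f z)%N) c (skip2 z) (skip2 (f z)).
Proof.
rewrite big_mkcond big3 /= ext_b ext_a val_a.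
have -> : bump b a' = a' := val_a.
rewrite ab [(b < a')%N]ltnNge (ltnW ab) mul1r.
congr (_ * _); rewrite [RHS]big_mkcond; apply: eq_bigr => z _.
by rewrite ext_h -!val_h h_lt.
Qed.

End RemovePair.

Section Wick.
Variables (R : realType) (q : R).
Implicit Types c : nat -> nat -> R.

Definition pairweight r c (f : {ffun 'I_r -> 'I_r}) : R :=
  q ^+ crossings f * \prod_(a : 'I_r | (a < f a)%N) c a (f a).

Definition sepwick r s c : R :=
  \sum_(f : {ffun 'I_r -> 'I_r} | is_pairing f && separated s f) pairweight c f.

Lemma sepwick_removed r (b : 'I_r.+2) (a' : 'I_r.+1) c : (a' < b)%N ->
  \sum_(f : {ffun 'I_r.+2 -> 'I_r.+2} |
      [&& is_pairing f, separated b f & f b == lift b a']) pairweight c f =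
  q ^+ (b.-1 - a') * (c a' b *
    sepwick r b.-1 (fun i j => c (bump b (bump a' i)) (bump b (bump a' j)))).
Proof.
move=> ab.
rewrite (reindex_onto (insert_pair b a') (delete_pair b a')) /=; last first.
  by move=> f /and3P[pf _ /eqP fb]; apply: delete_pairK.
rewrite /sepwick !mulr_sumr; apply: eq_big => f.
  rewrite insert_pairK eqxx andbT insert_pair_pairing insert_pair_separated //.
  by rewrite ffunE unlift_none eqxx andbT.
move=> /andP[/and3P[_ sf _] _].
rewrite insert_pair_separated // in sf.
rewrite /pairweight crossings_insert_pair // prod_insert_pair // exprD.
by rewrite -!mulrA; congr (_ * _); rewrite mulrCA.
Qed.

Lemma sepwick_remove r N (a b : 'I_N) c : N = r.+2 -> (a < b)%N ->
  \sum_(f : {ffun 'I_N -> 'I_N} |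
      [&& is_pairing f, separated b f & f b == a]) pairweight c f =
  q ^+ (b.-1 - a) * (c a b *
    sepwick r b.-1 (fun i j => c (bump b (bump a i)) (bump b (bump a j)))).
Proof.
move=> eN; subst N => ab.
have ar : (a < r.+1)%N by apply: leq_trans ab _; rewrite -ltnS ltn_ord.
have -> : a = lift b (Ordinal ar).
  by apply: val_inj; rewrite /= /bump leqNgt ab.
rewrite sepwick_removed //=.
by have -> : bump b a = a by rewrite /bump leqNgt ab.
Qed.

Lemma sepwick_split r (b : 'I_r) c :
  sepwick r b c = sepwick r b.+1 c +
    \sum_(a : 'I_r | (a < b)%N) \sum_(f : {ffun 'I_r -> 'I_r} |
      [&& is_pairing f, separated b f & f b == a]) pairweight c f.
Proof.
rewrite /sepwick (bigID (fun f : {ffun 'I_r -> 'I_r} => (b < f b)%N)) /=.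
congr (_ + _).
  apply: eq_bigl => f; case pf : (is_pairing f) => //=.
  have ff x : f (f x) = x by have /forallP/(_ x)/andP[/eqP] := pf.
  apply/andP/forallP => [[/forallP sf bf] x|sf].
    apply/implyP; rewrite ltnS leq_eqVlt => /orP[/eqP/val_inj->//|xb].
    rewrite ltn_neqAle (implyP (sf x) xb) andbT.
    by apply: contraTneq bf => /val_inj e; rewrite {2}e ff -leqNgt ltnW.
  split; last by have := sf b; rewrite leqnn.
  apply/forallP => x; apply/implyP => xb.
  by have := sf x; rewrite ltnS (ltnW xb) => /ltnW.
rewrite (partition_big (fun f : {ffun 'I_r -> 'I_r} => f b)
   (fun a : 'I_r => (a < b)%N)) /=; last first.
  move=> f /andP[/andP[/forallP/(_ b)/andP[_ fb] _]].
  rewrite -leqNgt leq_eqVlt => /orP[/eqP/val_inj e|//].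
  by rewrite e eqxx in fb.
apply: eq_bigr => a ab; apply: eq_bigl => f.
case: eqP => [->|]; last by rewrite !andbF.
by rewrite -leqNgt ltnW // !andbT.
Qed.

Lemma annih_sum (T : Type) (x0 : T) (cov : T -> T -> R) x K s :
  annih q cov x K s = \sum_(i < size s)
    q ^+ i * (cov (nth x0 s i) x * K (take i s ++ drop i.+1 s)).
Proof.
elim: s K => [|a s IH] K /=; first by rewrite big_ord0.
rewrite big_ord_recl /= expr0 mul1r drop0 IH mulr_sumr; congr (_ + _).
by apply: eq_bigr => i _; rewrite exprS -mulrA.
Qed.

Lemma nth_bump (T : Type) (x0 : T) u y v z :
  nth x0 (u ++ y :: v) (bump (size u) z) = nth x0 (u ++ v) z.
Proof.
rewrite !nth_cat /bump; case: (leqP (size u) z) => h.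
  by rewrite add1n ltnNge ltnW //= subSn.
by rewrite add0n h.
Qed.

Lemma eq_sepwick r s c c' : (forall i j, (i < r)%N -> (j < r)%N -> c i j = c' i j) ->
  sepwick r s c = sepwick r s c'.
Proof.
move=> e; apply: eq_bigr => f _; congr (_ * _).
by apply: eq_bigr => a _; rewrite e.
Qed.

(* Scanning the points from left to right, the stack holds the points that
   wait for a partner; pairing off its [i]-th entry creates [i] crossings. *)
Lemma sepwick_fock (T : Type) (x0 : T) (cov : T -> T -> R) s w :
  sepwick (size s + size w) (size s)
    (fun i j => cov (nth x0 (rev s ++ w) i) (nth x0 (rev s ++ w) j)) =
  fock q cov w s.
Proof.
elim: w s => [|x w IH] s.
  rewrite addn0 /= /vac /sepwick; case: s => [|y s] /=.
    rewrite (big_pred1 [ffun x => x]); last first.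
      move=> f; apply/andP/eqP => [_|_]; first by apply/ffunP => -[].
      by split; apply/forallP => -[].
    rewrite /pairweight [\prod_(_ | _) _]big1 ?mulr1; last by case.
    by rewrite crossings_sum big_ord0.
  rewrite big1 // => f /andP[_ /forallP/(_ ord0)] /=.
  by rewrite leqNgt ltn_ord.
have bs : (size s < size s + (size w).+1)%N by rewrite addnS ltnS leq_addr.
rewrite [size (x :: w)]/= -[X in sepwick _ X]/(nat_of_ord (Ordinal bs)).
rewrite sepwick_split [X in X + _]/=; congr (_ + _).
  have := IH (x :: s); rewrite /= addSnnS rev_cons cat_rcons; exact.
(* The head of the stack is the point opened last, so position [i] from the left is entry
   [size s - i.+1] of [s]. *)
rewrite (annih_sum x0) [RHS](reindex_inj rev_ord_inj) /=.
rewrite (big_ord_narrow (ltnW bs)) /=; apply: eq_bigr => i _.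
have is_ := ltn_ord i.
set r := ((size s).-1 + size w)%N.
etransitivity.
  by apply: (@sepwick_remove r _ _ (Ordinal bs)) => //; rewrite /r; lia.
rewrite /=.
set k := (size s - i.+1)%N.
have ks : (k < size s)%N by rewrite /k; lia.
have -> : ((size s).-1 - i = k)%N by rewrite /k; lia.
congr (_ * (_ * _)).
  rewrite !nth_cat size_rev is_ ltnn subnn nth_rev //.
apply: etrans (IH _).
have sz : size (take k s ++ drop k.+1 s) = (size s).-1.
  by rewrite size_cat size_take size_drop ks; lia.
rewrite sz; apply: eq_sepwick => i1 i2 _ _.
have es : rev s = rev (drop k.+1 s) ++ nth x0 s k :: rev (take k s).
  by rewrite -{1}(cat_take_drop k s) (drop_nth x0 ks) rev_cat rev_cons cat_rcons.
have si : size (rev (drop k.+1 s)) = i by rewrite size_rev size_drop /k; lia.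
have e z : nth x0 (rev s ++ x :: w) (bump (size s) (bump i z)) =
    nth x0 (rev (take k s ++ drop k.+1 s) ++ w) z.
  rewrite -{1}(size_rev s) nth_bump es -catA cat_cons -{1}si nth_bump.
  by rewrite rev_cat -catA.
by rewrite !e.
Qed.

Lemma wick_sepwick r (d : 'I_r -> 'I_r -> R) c :
  (forall i j : 'I_r, d i j = c i j) -> wick q d = sepwick r 0 c.
Proof.
move=> e; apply: eq_big => [f|f _].
  have -> : separated 0 f by apply/forallP => x; rewrite leq0n implybT.
  by rewrite andbT.
by congr (_ * _); apply: eq_bigr => a _.
Qed.

Theorem wick_fock (T : Type) r (lab : 'I_r -> T) (cov : T -> T -> R) :
  wick q (fun a b => cov (lab a) (lab b)) =
  fock q cov [seq lab i | i <- enum 'I_r] [::].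
Proof.
case: r lab => [|r] lab.
  (* Without points there is no label to serve as default of [nth], hence the passage through
     [unit]. *)
  rewrite enum_ord0 -[RHS](sepwick_fock tt (fun _ _ => 0) [::] [::]).
  by apply: wick_sepwick => -[].
rewrite -(sepwick_fock (lab ord0)) size_map size_enum_ord.
apply: wick_sepwick => i j; rewrite [rev [::]]/= cat0s.
have e (k : 'I_r.+1) : nth (lab ord0) [seq lab i | i <- enum 'I_r.+1] k = lab k.
  by rewrite (nth_map ord0) ?size_enum_ord // nth_ord_enum.
by rewrite !e.
Qed.

End Wick.

(** * Inversions and q-Hermite moments *)

Lemma inv_count_sum n (s : 'S_n) :
  inv_count s = (\sum_(i < n) \sum_(j < n) ((i < j) && (s j < s i)))%N.
Proof.
rewrite /inv_count cardsE -sum1_card pair_big /= big_mkcond /=.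
by apply: eq_bigr => -[i j] _ /=; rewrite unfold_in /=; case: ifP.
Qed.

(** The first value [j] exceeds exactly [j] of the later ones, and lifting preserves the order of
    the others. Summing over [j] produces the factor [qsum n.+1] of the q-factorial. *)
Lemma inv_count_lift n (j : 'I_n.+1) (s : 'S_n) :
  inv_count (lift_perm ord0 j s) = (j + inv_count s)%N.
Proof.
rewrite !inv_count_sum big_ord_recl big_ord_recl ltnn add0n lift_perm_id.
congr (_ + _)%N.
  under eq_bigr do rewrite lift_perm_lift /=.
  transitivity (\sum_(y < n) (bump j y < j))%N.
    by rewrite [RHS](reindex_inj (@perm_inj _ s)).
  under eq_bigr => y _.
    have -> : (bump j y < j)%N = (0 <= y < j)%N by rewrite /bump; lia.
    over.
  by rewrite sum_ord_range; have := ltn_ord j; lia.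
apply: eq_bigr => i _; rewrite big_ord_recl ltn0 add0n.
apply: eq_bigr => k _; rewrite !lift_perm_lift /=.
by congr (nat_of_bool (_ && _)); rewrite /bump; lia.
Qed.

Lemma sum_inv_count (R : realType) (q : R) n :
  \sum_(s : 'S_n) q ^+ inv_count s = qfact q n.
Proof.
elim: n => [|n IH].
  rewrite qfact0 (big_pred1 1%g) => [|s]; last first.
    by apply/esym/eqP/permP => -[].
  by rewrite inv_count_sum big_ord0.
rewrite qfactS -IH /qsum.
have lift_inj2 : injective (fun p : 'I_n.+1 * 'S_n => lift_perm ord0 p.1 p.2).
  move=> [j s] [j' s'] /= /permP e.
  have ej : j = j' by have := e ord0; rewrite !lift_perm_id.
  subst j'; congr (_, _); apply/permP => k; apply: (@lift_inj _ j).
  by have := e (lift ord0 k); rewrite !lift_perm_lift.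
rewrite (reindex _ (onW_bij _ (inj_card_bij lift_inj2 _))) /=; last first.
  by rewrite card_prod card_ord !card_Sn factS.
rewrite big_distrlr pair_big /=.
by apply: eq_bigr => -[j s] _; rewrite inv_count_lift exprD.
Qed.

Local Open Scope complex_scope.
Section Moments.
Variables (R : realType) (q : R) (A : algType R[i]) (phi : A -> R[i]).
Hypothesis phiL : forall (a : R[i]) (x y : A), phi (a *: x + y) = a * phi x + phi y.

Lemma peval_horner (p : {poly R}) (x : A) :
  peval p x = horner_alg x (map_poly (real_complex R) p).
Proof.
rewrite /horner_alg /horner_morph (horner_coef_wide (n := size p)); last first.
  exact: leq_trans (size_poly _ _) (size_poly _ _).
apply: eq_bigr => i _; rewrite !coef_map /=.
by rewrite mulr_algl.
Qed.

Lemma peval1 (x : A) : peval 1 x = 1.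
Proof. by rewrite peval_horner rmorph1 rmorph1. Qed.

Lemma pevalX (x : A) : peval 'X x = x.
Proof. by rewrite peval_horner map_polyX horner_algX. Qed.

Lemma qintE n : qint q n = qsum q n.
Proof.
rewrite /qint; case: eqP => [->|/eqP q1].
  by rewrite /qsum; under eq_bigr do rewrite expr1n; rewrite sumr_const card_ord.
by apply: (canLR (mulfK _)); rewrite ?subr_eq0 1?eq_sym // -[X in X - _](expr1n _ n)
   subrXX mulrC; congr (_ * _); apply: eq_bigr => i _; rewrite expr1n mul1r.
Qed.

Lemma qHermiteSS n :
  qHermite q n.+2 = 'X * qHermite q n.+1 - qsum q n.+1 *: qHermite q n.
Proof. by rewrite /qHermite /= -qintE; case: (qHermite_pair q n). Qed.

Lemma peval_qHermiteSS n (x : A) : peval (qHermite q n.+2) x =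
  x * peval (qHermite q n.+1) x - (qsum q n.+1)%:C *: peval (qHermite q n) x.
Proof.
rewrite qHermiteSS !peval_horner rmorphB rmorphM /= map_polyX map_polyZ /=.
by rewrite rmorphB rmorphM /= horner_algX linearZ /= mulr_algl.
Qed.

Variables (T : Type) (cov : T -> T -> R) (Z : T -> A).
Hypothesis cov1 : forall x, cov x x = 1.
Hypothesis phiZ : forall u : seq T,
  phi (\prod_(x <- u) Z x) = (fock q cov u [::])%:C.

Let word u K := foldr (qfield q cov) K u.

Lemma word_linear u K K' c s :
  word u (fun t => K t - c * K' t) s = word u K s - c * word u K' s.
Proof.
elim: u s => //= x u IH s; rewrite /qfield IH.
rewrite (eq_annih _ _ _ _ IH).
have -> : annih q cov x (fun t => word u K t - c * word u K' t) s =
    annih q cov x (word u K) s + - c * annih q cov x (word u K') s.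
  by rewrite -annihZ -annihD; apply: eq_annih => t; rewrite mulNr.
by ring.
Qed.

Lemma eq_word u K K' : K =1 K' -> word u K =1 word u K'.
Proof.
by move=> e; elim: u => //= x u IH s; rewrite /qfield IH (eq_annih _ _ _ _ IH).
Qed.

(** The prefix [u] stays arbitrary so that the factor [Z x] of the recurrence can be absorbed into
    it. The recurrence goes back two steps, hence the strong induction. *)
Lemma phi_qHermite_step n (y : A) x K :
  (forall u, phi (\prod_(z <- u) Z z * y) = (word u K [::])%:C) ->
  forall u, phi (\prod_(z <- u) Z z * (peval (qHermite q n) (Z x) * y)) =
     (word u (wickblock q cov x n 0 K) [::])%:C.
Proof.
move=> yK; have phiB a b c : phi (a - c *: b) = phi a - c * phi b.
  by rewrite addrC -scaleNr phiL mulNr addrC.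
have cat1 u : \prod_(z <- u) Z z * Z x = \prod_(z <- u ++ [:: x]) Z z.
  by rewrite big_cat big_seq1.
have X1 u : phi (\prod_(z <- u) Z z * (Z x * y)) =
    (word u (qfield q cov x K) [::])%:C.
  rewrite mulrA cat1 yK.
  by rewrite /word foldr_cat.
elim/ltn_ind: n => -[|[|n]] IH u.
- by rewrite peval1 mul1r yK.
- rewrite pevalX X1; congr (_%:C); apply: eq_word => s.
  by rewrite /= expr0 mul1r.
rewrite peval_qHermiteSS mulrBl mulrBr -mulrA -!scalerAl -scalerAr phiB.
have -> : phi (\prod_(z <- u) Z z * (Z x * (peval (qHermite q n.+1) (Z x) * y)))
   = (word u (qfield q cov x (wickblock q cov x n.+1 0 K)) [::])%:C.
  rewrite mulrA cat1 IH //.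
  by rewrite /word foldr_cat.
rewrite IH // -rmorphM -rmorphB; congr (_%:C); rewrite -word_linear.
apply: eq_word => s; rewrite qfield_wickblock //=; ring.
Qed.

Theorem phi_qHermite n w :
  phi (\prod_(x <- w) peval (qHermite q n) (Z x)) =
  (blockfock q cov n w [::])%:C.
Proof.
suff H u : phi (\prod_(z <- u) Z z * \prod_(x <- w) peval (qHermite q n) (Z x)) =
   (word u (blockfock q cov n w) [::])%:C.
  by have := H [::]; rewrite big_nil mul1r.
elim: w u => [|x w IH] u; first by rewrite big_nil mulr1 phiZ.
by rewrite big_cons; apply: phi_qHermite_step.
Qed.

End Moments.

(** * Sums over Z *)

Local Open Scope classical_set_scope.
Local Open Scope ring_scope.

Section Zpartial.
Variable R : realType.
Implicit Types f g h : int -> R.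

Lemma zpartialS f N :
  zpartial f N.+1 = zpartial f N + (f (N.+1)%:Z + f (- (N.+1)%:Z)).
Proof.
rewrite /zpartial doubleS big_nat_recl // big_nat_recr //.
rewrite addrC -addrA; congr (_ + (f _ + f _)); [|lia|lia].
by apply: eq_bigr => i _; congr f; lia.
Qed.

Lemma zpartialB f g N : zpartial (fun l => f l - g l) N = zpartial f N - zpartial g N.
Proof. by rewrite /zpartial sumrB. Qed.

Lemma zpartialD f g N : zpartial (fun l => f l + g l) N = zpartial f N + zpartial g N.
Proof. by rewrite /zpartial big_split. Qed.

Lemma zpartialZ c f N : zpartial (fun l => c * f l) N = c * zpartial f N.
Proof. by rewrite /zpartial mulr_sumr. Qed.

Lemma zpartial_cst (c : R) N : zpartial (fun=> c) N = c * (N.*2.+1)%:R.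
Proof. by rewrite /zpartial sumr_const_nat subn0 mulr_natr. Qed.

Lemma zpartial_ge0 f N : (forall l, 0 <= f l) -> 0 <= zpartial f N.
Proof. by move=> f0; apply: sumr_ge0. Qed.

Lemma zpartial_nondecreasing f N M : (forall l, 0 <= f l) -> (N <= M)%N ->
  zpartial f N <= zpartial f M.
Proof.
move=> f0; elim: M => [|M IH]; first by rewrite leqn0 => /eqP->.
rewrite leq_eqVlt => /orP[/eqP->//|]; rewrite ltnS => /IH h.
by rewrite zpartialS; apply: le_trans h _; rewrite lerDl addr_ge0.
Qed.

Lemma sum_shift_window f K (y N : nat) : (y <= K)%N ->
  \sum_(0 <= x < N) f (x%:Z - y%:Z) =
  \sum_(K - y <= i < K - y + N) f (i%:Z - K%:Z).
Proof.
move=> yK; rewrite -{1}[(K - y)%N]add0n big_addn addKn.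
by apply: eq_big_nat => x _; congr f; lia.
Qed.

Lemma zpartial_window f K J : (J <= K)%N ->
  zpartial f J = \sum_(K - J <= i < K + J.+1) f (i%:Z - K%:Z).
Proof.
move=> JK; rewrite /zpartial -{1}[(K - J)%N]add0n big_addn.
have -> : (K + J.+1 - (K - J) = J.*2.+1)%N by lia.
by apply: eq_big_nat => i _; congr f; lia.
Qed.

Lemma le_window (F : nat -> R) a a' b' b : (forall i, 0 <= F i) ->
  (a <= a')%N -> (a' <= b')%N -> (b' <= b)%N ->
  \sum_(a' <= i < b') F i <= \sum_(a <= i < b) F i.
Proof.
move=> F0 h1 h2 h3.
rewrite [X in _ <= X](big_cat_nat (n := a')) ?(leq_trans h2) //=.
rewrite [X in _ <= _ + X](big_cat_nat (n := b')) //=.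
by rewrite addrCA lerDl addr_ge0 // sumr_ge0.
Qed.

Lemma dist_window (F : nat -> R) a a' b' b :
  (a <= a')%N -> (a' <= b')%N -> (b' <= b)%N ->
  `|\sum_(a <= i < b) F i - \sum_(a' <= i < b') F i| <=
  \sum_(a <= i < b) `|F i| - \sum_(a' <= i < b') `|F i|.
Proof.
move=> h1 h2 h3.
have split (G : nat -> R) : \sum_(a <= i < b) G i - \sum_(a' <= i < b') G i =
    \sum_(a <= i < a') G i + \sum_(b' <= i < b) G i.
  rewrite (big_cat_nat (n := a')) ?(leq_trans h2) //=.
  by rewrite [X in _ + X - _](big_cat_nat (n := b')) //=; ring.
by rewrite !split (le_trans (ler_normD _ _)) // lerD // ler_norm_sum.
Qed.

Lemma sum_shift_le f (N y K : nat) : (forall l, 0 <= f l) -> (y <= K)%N ->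
  (N <= K)%N -> \sum_(0 <= x < N) f (x%:Z - y%:Z) <= zpartial f K.
Proof.
move=> f0 yK NK; rewrite (sum_shift_window _ _ yK); apply: le_window => //; lia.
Qed.

Lemma abs_summable_cauchy f : abs_summable_Z f ->
  forall e, 0 < e -> exists L, forall K, (L <= K)%N ->
    zpartial (fun l => `|f l|) K - zpartial (fun l => `|f l|) L <= e.
Proof.
move=> [M fM] e e0; set u := zpartial _ in fM *.
have nd : nondecreasing_seq u.
  by move=> N K; apply: zpartial_nondecreasing.
have cu : cvgn u.
  by apply: nondecreasing_is_cvgn => //; exists M => _ [N _ <-].
have /cvgrPdist_le/(_ e e0)[L _ hL] := cu.
exists L => K LK; have := hL L (leqnn L).
have := nondecreasing_cvgn_le nd cu K; have := nondecreasing_cvgn_le nd cu L.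
move=> /= h1 h2; rewrite ger0_norm ?subr_ge0 // => h3.
by apply: le_trans h3; rewrite lerD2r.
Qed.

Lemma nondecreasing_zpartial_cvg f M : (forall l, 0 <= f l) ->
  (forall N, zpartial f N <= M) -> cvgn (zpartial f).
Proof.
move=> f0 fM; apply: nondecreasing_is_cvgn; last by exists M => _ [N _ <-].
by move=> N K; apply: zpartial_nondecreasing.
Qed.

Lemma zsum_cvg f : abs_summable_Z f -> zpartial f @ \oo --> zsum f.
Proof.
move=> [M fM].
have fN l : 0 <= f l + `|f l| by have := ler_norm (- f l); rewrite normrN; lra.
have c1 := nondecreasing_zpartial_cvg (fun l => normr_ge0 (f l)) fM.
(* Both [f + |f|] and [|f|] are nonnegative with bounded partial sums, and [f] is their
   difference. *)
have c2 : cvgn (zpartial (fun l => f l + `|f l|)).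
  apply: (@nondecreasing_zpartial_cvg _ (M + M)) => // N; rewrite zpartialD lerD //.
  apply: le_trans (fM N); apply: ler_sum => i _; exact: ler_norm.
have e : zpartial f = (zpartial (fun l => f l + `|f l|)
    \- zpartial (fun l => `|f l|)).
  by apply/funext => N /=; rewrite zpartialD addrK.
suff : cvgn (zpartial f) by [].
by rewrite e; apply: is_cvgB.
Qed.

End Zpartial.

Section Truncation.
Variable R : realType.

Definition npts (k : nat) (t : R) : nat := (Num.truncn (k%:R * t)).+1.

Lemma npts_bounds k t : 0 <= t -> k%:R * t <= (npts k t)%:R <= k%:R * t + 1.
Proof.
move=> t0; have /truncn_itv/andP[h1 h2] : 0 <= k%:R * t by rewrite mulr_ge0.
by rewrite /npts (ltW h2) -natr1 lerD2r h1.
Qed.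

Lemma npts_le k s t : s <= t -> (npts k s <= npts k t)%N.
Proof. by move=> st; rewrite ltnS le_truncn // ler_wpM2l. Qed.

Lemma npts_cvg t : 0 <= t -> (fun k => (npts k t)%:R / k%:R : R) @ \oo --> t.
Proof.
move=> t0; apply: (@squeeze_cvgr _ _ _ _ (fun=> t) (fun k => t + k%:R^-1)).
- near=> k; have k0 : 0 < k%:R :> R by rewrite ltr0n; near: k; exact: nbhs_infty_gt.
  have /andP[h1 h2] := npts_bounds k t0.
  rewrite ler_pdivlMr // mulrC h1 /= ler_pdivrMr // mulrDl mulVf ?gt_eqF //.
  by rewrite [t * _]mulrC.
- exact: cvg_cst.
rewrite -[X in _ --> X]addr0; apply: cvgD; first exact: cvg_cst.
by rewrite -cvg_shiftS; exact: cvg_harmonic.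
Unshelve. all: by end_near. Qed.

End Truncation.

(** * Double sums of a summable even kernel over growing rectangles *)

Section PairSums.
Variables (R : realType) (g : int -> R).
Hypothesis g_even : forall l, g (- l) = g l.

Lemma invn_cvg0 : (fun k : nat => k%:R^-1 : R) @ \oo --> 0.
Proof. by rewrite -cvg_shiftS; exact: cvg_harmonic. Qed.

(** A row sums [g] over a window of the integers. Away from both ends by [J], the window contains
    [[-J, J]] and the error is part of a tail; any other row costs at most [2 * B]. *)
Lemma row_sum_dist (B e : R) J M (x : nat) : 0 <= e ->
  (forall K, zpartial (fun l => `|g l|) K <= B) ->
  (forall K, (J <= K)%N ->
    zpartial (fun l => `|g l|) K - zpartial (fun l => `|g l|) J <= e) ->
  (x < M)%N ->
  `|\sum_(0 <= y < M) g (x%:Z - y%:Z) - zpartial g J| <=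
    e + 2 * B * ((0 <= x < J) + (M - J <= x < M))%:R.
Proof.
move=> e0 gB gJ xM; have B0 : 0 <= B by apply: le_trans (gB 0); apply: zpartial_ge0.
have -> : \sum_(0 <= y < M) g (x%:Z - y%:Z) = \sum_(0 <= y < M) g (y%:Z - x%:Z).
  by apply: eq_big_nat => y _; rewrite -g_even opprB.
case: (boolP ((J <= x) && (x + J < M)))%N => [/andP[Jx xJ]|out].
  rewrite [X in _ <= X](_ : _ = e); last first.
    have -> : ((0 <= x < J) + (M - J <= x < M) = 0)%N by lia.
    by rewrite mulr0 addr0.
  set K := (M + J)%N; have JK : (J <= K)%N by rewrite /K; lia.
  apply: le_trans (gJ K JK).
  rewrite (@sum_shift_window _ _ K) 1?(@zpartial_window _ _ K) //; last first.
    by rewrite /K; lia.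
  apply: le_trans (dist_window _ _ _ _) _; try by rewrite /K; lia.
  rewrite [X in _ <= _ - X](@zpartial_window _ _ K) // lerD2r.
  by apply: le_window => //; rewrite /K; lia.
apply: (@le_trans _ _ (2 * B)); last first.
  have h : (1 <= (0 <= x < J) + (M - J <= x < M))%N by lia.
  have : 1 <= ((0 <= x < J) + (M - J <= x < M))%N%:R :> R by rewrite ler1n.
  by nra.
rewrite [2 * B]mulr_natl mulr2n (le_trans (ler_normB _ _)) // lerD //.
  apply: le_trans (ler_norm_sum _ _ _) _; apply: le_trans (gB M).
  by apply: (@sum_shift_le _ (fun l => `|g l|)) => //; exact: ltnW.
apply: le_trans (gB J); exact: ler_norm_sum.
Qed.

(** At most [2 * J] rows are close to an end, whatever [N], so their share vanishes after division
    by [k]. *)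
Lemma square_sum_dist (B e : R) J N M : 0 <= e ->
  (forall K, zpartial (fun l => `|g l|) K <= B) ->
  (forall K, (J <= K)%N ->
    zpartial (fun l => `|g l|) K - zpartial (fun l => `|g l|) J <= e) ->
  (N <= M)%N ->
  `|\sum_(0 <= x < N) \sum_(0 <= y < M) g (x%:Z - y%:Z) - N%:R * zpartial g J| <=
    N%:R * e + 4 * B * J%:R.
Proof.
move=> e0 gB gJ NM; have B0 : 0 <= B by apply: le_trans (gB 0); apply: zpartial_ge0.
have cst (c : R) : N%:R * c = \sum_(0 <= x < N) c.
  by rewrite sumr_const_nat subn0 mulr_natl.
rewrite cst -sumrB (le_trans (ler_norm_sum _ _ _)) //.
apply: (@le_trans _ _ (\sum_(0 <= x < N)
   (e + 2 * B * ((0 <= x < J) + (M - J <= x < M))%:R))).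
  rewrite big_nat [X in _ <= X]big_nat; apply: ler_sum => x /andP[_ xN].
  by apply: row_sum_dist => //; exact: leq_trans NM.
rewrite big_split /= -cst lerD2l -mulr_sumr -natr_sum.
have -> : 4 * B * J%:R = 2 * B * (2 * J)%:R by rewrite natrM; ring.
rewrite ler_wpM2l ?mulr_ge0 // ler_nat big_mkord big_split /=.
by have := sum_ord_range N 0 J; rewrite /= => ->; rewrite sum_ord_range; lia.
Qed.

Lemma pair_sum_cvg_le s t : abs_summable_Z g -> 0 <= s -> s <= t ->
  (fun k => k%:R^-1 *
     \sum_(0 <= x < npts k s) \sum_(0 <= y < npts k t) g (x%:Z - y%:Z)) @ \oo
    --> zsum g * s.
Proof.
move=> sg s0 st; have [B gB] := sg; have zg := zsum_cvg sg.
apply/cvgrPdist_lt => e e0; set z := zsum g in zg *.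
(* Eventually [npts k s / k <= s + 1]. The two terms weighted by this ratio then cost [e / 4] each,
   and [e / 2] remains for the boundary rows and the rounding. *)
pose e' := e / (4 * (s + 1)).
have e'0 : 0 < e' by rewrite divr_gt0 // mulr_gt0 //; lra.
have [L1 hL1] := abs_summable_cauchy sg e'0.
have /cvgrPdist_le/(_ e' e'0)[L2 _ hL2] := zg.
pose J := maxn L1 L2.
have gJ K : (J <= K)%N ->
    zpartial (fun l => `|g l|) K - zpartial (fun l => `|g l|) J <= e'.
  move=> JK; apply: le_trans (hL1 K _); last by rewrite /J in JK; lia.
  rewrite lerD2l lerN2; apply: zpartial_nondecreasing => //; rewrite /J; lia.
have zJ : `|z - zpartial g J| <= e' by apply: hL2; rewrite /= /J; lia.
have Ncvg := npts_cvg s0.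
have v0 : (fun k => 4 * B * J%:R * k%:R^-1
    + `|(npts k s)%:R / k%:R - s| * `|z|) @ \oo --> (0 : R).
  rewrite -[X in _ --> X](addr0 0); apply: cvgD.
    rewrite -[X in _ --> X](mulr0 (4 * B * J%:R)); apply: cvgMr.
    exact: invn_cvg0.
  rewrite -[X in _ --> X](mul0r `|z|); apply: cvgMl.
  rewrite -[X in _ --> X](normr0 R); apply: cvg_norm.
  by rewrite -[X in _ --> X](subrr s); apply: cvgB => //; exact: cvg_cst.
have e20 : 0 < e / 2 by lra.
near=> k.
have k0 : 0 < k%:R :> R by rewrite ltr0n; near: k; exact: nbhs_infty_gt.
have N1 : (npts k s)%:R / k%:R <= s + 1.
  have : `|s - (npts k s)%:R / k%:R| < 1.
    by near: k; have /cvgrPdist_lt/(_ 1 ltr01) := Ncvg.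
  by rewrite ltr_norml => /andP[]; lra.
have vk : 4 * B * J%:R * k%:R^-1 + `|(npts k s)%:R / k%:R - s| * `|z| < e / 2.
  have : `|0 - (4 * B * J%:R * k%:R^-1 + `|(npts k s)%:R / k%:R - s| * `|z|)| < e / 2.
    by near: k; have /cvgrPdist_lt/(_ _ e20) := v0.
  by rewrite sub0r normrN; apply: le_lt_trans; exact: ler_norm.
have := square_sum_dist (ltW e'0) gB gJ (npts_le k st).
set S := \sum_(0 <= x < _) _; set N := (npts k s)%:R in N1 vk * => hS.
(* The three errors: the comparison of the rows with the truncated series, the truncation at [J],
   and the rounding of [k * s]. *)
have -> : z * s - k%:R^-1 * S = - (k%:R^-1 * (S - N * zpartial g J))
   + N / k%:R * (z - zpartial g J) - (N / k%:R - s) * z by field; rewrite gt_eqF.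
have h1 : `|k%:R^-1 * (S - N * zpartial g J)| <= N / k%:R * e' + 4 * B * J%:R * k%:R^-1.
  rewrite normrM gtr0_norm ?invr_gt0 //.
  apply: le_trans (ler_wpM2l _ hS) _; first by rewrite invr_ge0 ltW.
  by rewrite mulrDr mulrA [_^-1 * N]mulrC [_^-1 * _]mulrC.
have Nk0 : 0 <= N / k%:R by rewrite divr_ge0.
have h2 : `|N / k%:R * (z - zpartial g J)| <= N / k%:R * e'.
  by rewrite normrM (ger0_norm Nk0) ler_wpM2l.
have h3 : N / k%:R * e' <= e / 4.
  apply: le_trans (ler_wpM2r (ltW e'0) N1) _; rewrite /e' le_eqVlt; apply/orP; left.
  by apply/eqP; field; rewrite gt_eqF //; lra.
apply: le_lt_trans (ler_normB _ _) _; rewrite [`|(_ - _) * z|]normrM.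
apply: (@le_lt_trans _ _ (`|k%:R^-1 * (S - N * zpartial g J)|
  + `|N / k%:R * (z - zpartial g J)| + `|N / k%:R - s| * `|z|)).
  by rewrite lerD2r (le_trans (ler_normD _ _)) // normrN.
by lra.
Unshelve. all: by end_near. Qed.

Theorem pair_sum_cvg s t : abs_summable_Z g -> 0 <= s -> 0 <= t ->
  (fun k => k%:R^-1 *
     \sum_(0 <= x < npts k s) \sum_(0 <= y < npts k t) g (x%:Z - y%:Z)) @ \oo
    --> zsum g * Num.min s t.
Proof.
move=> sg s0 t0; case: (leP s t) => st; first exact: pair_sum_cvg_le.
have := pair_sum_cvg_le sg t0 (ltW st).
under eq_fun do rewrite exchange_big.
suff -> : (fun k => k%:R^-1 * \sum_(0 <= j < npts k s)
     \sum_(0 <= i < npts k t) g (i%:Z - j%:Z)) = (fun k => k%:R^-1 *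
     \sum_(0 <= x < npts k s) \sum_(0 <= y < npts k t) g (x%:Z - y%:Z)) by [].
apply/funext => k; congr (_ * _).
by apply: eq_bigr => x _; apply: eq_bigr => y _; rewrite -g_even opprB.
Qed.

End PairSums.

(** * Power sums of the covariance *)

(** The first case is [x <= d]; beyond [d] the missing powers of [x / d] are at least [1]. Summed
    with [d] of order [K^(-1/n)], both terms balance, which takes the place of Hölder's
    inequality. *)
Lemma expr_le_young (R : realFieldType) (x d : R) m n : 0 <= x -> 0 < d -> (m <= n)%N ->
  x ^+ m <= d^-1 ^+ (n - m) * x ^+ n + d ^+ m.
Proof.
move=> x0 d0 mn; have dV : 0 <= d^-1 by rewrite invr_ge0 ltW.
case: (leP x d) => xd.
  rewrite ler_wpDl ?mulr_ge0 ?exprn_ge0 //.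
  by rewrite lerXn2r ?nnegrE // ltW.
apply: ler_wpDr; first by rewrite exprn_ge0 // ltW.
have -> : x ^+ n = x ^+ (n - m) * x ^+ m by rewrite -exprD subnK.
rewrite mulrA -exprMn ler_peMl ?exprn_ge0 //.
by rewrite exprn_ege1 // mulrC ler_pdivlMr // mul1r ltW.
Qed.

(** Each factor is at most the largest one. The last term covers the empty product, equal to [1]
    while the sum is [0]. *)
Lemma prod_le_sum_expr (R : realFieldType) (I : eqType) (s : seq I) (F : I -> R) :
  (forall i, 0 <= F i) ->
  \prod_(i <- s) F i <= \sum_(i <- s) F i ^+ size s + (s == [::])%:R.
Proof.
move=> F0; case: s => [|i0 s]; first by rewrite !big_nil add0r.
rewrite addr0; set s1 := i0 :: s.
have [j js jmax] : exists2 j, j \in s1 & forall i, i \in s1 -> F i <= F j.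
  rewrite /s1; elim: s {s1} => [|i s [j js jmax]].
    by exists i0; rewrite ?mem_head // => i; rewrite inE => /eqP->.
  case: (leP (F i) (F j)) => h.
    exists j; first by move: js; rewrite !inE => /orP[]->; rewrite ?orbT.
    move=> l; rewrite !inE => /or3P[/eqP->|/eqP->//|ls].
    - by apply: jmax; rewrite mem_head.
    by apply: jmax; rewrite inE ls orbT.
  exists i; first by rewrite !inE eqxx orbT.
  move=> l; rewrite !inE => /or3P[/eqP->|/eqP->//|ls]; apply: le_trans (ltW h).
  - by apply: jmax; rewrite mem_head.
  by apply: jmax; rewrite inE ls orbT.
apply: (@le_trans _ _ (F j ^+ size s1)).
  have -> : F j ^+ size s1 = \prod_(i <- s1) F j.
    by rewrite big_const_seq count_predT -Monoid.iteropE.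
  rewrite big_seq [X in _ <= X]big_seq; apply: ler_prod => i /jmax ->.
  by rewrite F0.
by rewrite (big_rem j js) /= lerDl sumr_ge0 // => i _; rewrite exprn_ge0.
Qed.

Section Growth.
Variables (R : realType) (rho : int -> R) (n : nat) (B : R).
Hypothesis n0 : (0 < n)%N.
Hypothesis rho_le1 : forall l, `|rho l| <= 1.
Hypothesis rho_summable : abs_summable_Z (fun l => `|rho l| ^+ n).
Hypothesis rho_bound : forall K, zpartial (fun l => `|rho l| ^+ n) K <= B.

Definition powsum m K := zpartial (fun l => `|rho l| ^+ m) K.
Definition nroot (k : nat) : R := k%:R `^ n%:R^-1.

Lemma nrootX k : nroot k ^+ n = k%:R.
Proof.
rewrite /nroot -powR_mulrn ?powR_ge0 // -powRrM mulVf ?powRr1 //.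
by rewrite pnatr_eq0 -lt0n.
Qed.

Lemma nroot_gt0 k : (0 < k)%N -> 0 < nroot k.
Proof. by move=> k0; rewrite powR_gt0 // ltr0n. Qed.

Lemma nroot_ge x k : 0 <= x -> x ^+ n <= k%:R -> x <= nroot k.
Proof. by move=> x0; rewrite -nrootX ler_pXn2r // nnegrE ?powR_ge0. Qed.

Lemma powsum_ge0 m K : 0 <= powsum m K.
Proof. by apply: zpartial_ge0 => l; rewrite exprn_ge0. Qed.

(** The inequality is summed over [L < |l| <= K] only, so that the [n]-th powers enter through a
    tail that can be made small. *)
Lemma powsum_le m L K (d : R) : 0 < d -> (m <= n)%N -> (L <= K)%N ->
  powsum m K <= powsum m L + d^-1 ^+ (n - m) * (powsum n K - powsum n L)
    + d ^+ m * (K.*2.+1)%:R.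
Proof.
move=> d0 mn LK; pose h l := d^-1 ^+ (n - m) * `|rho l| ^+ n + d ^+ m - `|rho l| ^+ m.
have h0 l : 0 <= h l by rewrite subr_ge0 expr_le_young.
have := zpartial_nondecreasing h0 LK.
rewrite /h !zpartialB !zpartialD !zpartialZ !zpartial_cst -/(powsum _ _).
rewrite -/(powsum m K) -/(powsum m L) -/(powsum n K).
have : 0 <= d ^+ m * (L.*2.+1)%:R by rewrite mulr_ge0 ?exprn_ge0 // ltW.
set c := d^-1 ^+ _; lra.
Qed.

Lemma powsum_le0 m K (d : R) : 0 < d -> (m <= n)%N ->
  powsum m K <= d^-1 ^+ (n - m) * powsum n K + d ^+ m * (K.*2.+1)%:R.
Proof.
move=> d0 mn; pose h l := d^-1 ^+ (n - m) * `|rho l| ^+ n + d ^+ m - `|rho l| ^+ m.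
have h0 l : 0 <= h l by rewrite subr_ge0 expr_le_young.
have := zpartial_ge0 K h0.
rewrite /h !zpartialB !zpartialD !zpartialZ !zpartial_cst -/(powsum _ _).
by rewrite -/(powsum m K) subr_ge0.
Qed.

Lemma powsum_le_card m L : powsum m L <= (L.*2.+1)%:R.
Proof.
rewrite -[X in _ <= X]mul1r -zpartial_cst; apply: ler_sum => i _.
by rewrite exprn_ile1.
Qed.

Variable T : nat.

Lemma scale_bound k m (c : R) : (0 < k)%N -> (m <= n)%N -> 0 <= c ->
  (c / nroot k) ^+ m * ((T * k).*2.+1)%:R <=
  c ^+ m * (T.*2.+1)%:R * nroot k ^+ (n - m).
Proof.
move=> k0 mn c0; have d0 := nroot_gt0 k0.
have e : nroot k ^+ (n - m) = k%:R / nroot k ^+ m.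
  have -> : k%:R = nroot k ^+ (n - m) * nroot k ^+ m.
    by rewrite -exprD subnK // nrootX.
  by rewrite mulfK // expf_neq0 // gt_eqF.
rewrite e exprMn exprVn -!mulrA ler_wpM2l ?exprn_ge0 //.
rewrite mulrC [X in _ <= X]mulrA ler_wpM2r ?invr_ge0 ?exprn_ge0 ?(ltW d0) //.
by rewrite -natrM ler_nat; nia.
Qed.

Lemma powsum_growth k m : (0 < k)%N -> (m <= n)%N ->
  powsum m (T * k) <= (B + (T.*2.+1)%:R) * nroot k ^+ (n - m).
Proof.
move=> k0 mn; have d0 := nroot_gt0 k0.
have dV0 : 0 < 1 / nroot k by rewrite divr_gt0.
apply: le_trans (powsum_le0 _ dV0 mn) _; rewrite mulrDl lerD //.
  rewrite div1r invrK mulrC ler_wpM2r ?exprn_ge0 ?(ltW d0) //.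
  exact: rho_bound.
by apply: le_trans (scale_bound k0 mn ler01) _; rewrite expr1n mul1r.
Qed.

(** Three contributions, each at most a third of the target: the head [|l| <= L], fixed while
    [nroot k ^+ (n - m)] grows because [m < n]; the tail of the [n]-th powers; and the number of
    terms weighted by [eta ^+ m], small because [0 < m]. *)
Lemma powsum_littleo m : (0 < m)%N -> (m < n)%N ->
  (fun k => powsum m (T * k) / nroot k ^+ (n - m)) @ \oo --> (0 : R).
Proof.
move=> m0 mn; apply/cvgrPdist_le => e e0.
set D := (T.*2.+1)%:R : R; have D0 : 0 < D by rewrite ltr0n.
pose eta : R := Num.min 1 (e / (3 * D)).
have eta0 : 0 < eta by rewrite lt_min ltr01 divr_gt0 // mulr_gt0.
have eta1 : eta <= 1 by rewrite ge_min lexx.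
have etaD : eta ^+ m * D <= e / 3.
  apply: (@le_trans _ _ (eta * D)).
    rewrite ler_wpM2r ?(ltW D0) // -[X in _ <= X]expr1.
    by rewrite ler_wiXn2l // ltW.
  rewrite -ler_pdivlMr // (_ : e / 3 / D = e / (3 * D)).
    by rewrite ge_min lexx orbT.
  by rewrite invfM mulrA.
(* The power of [eta] offsets the factor [d^-1 ^+ (n - m)] of [powsum_le] at [d = eta / nroot k]. *)
pose e' := e / 3 * eta ^+ (n - m).
have e'0 : 0 < e' by rewrite mulr_gt0 ?exprn_gt0 // divr_gt0.
have [L hL] := abs_summable_cauchy rho_summable e'0.
pose X : R := (L.*2.+1)%:R / (e / 3).
have X0 : 0 <= X by rewrite divr_ge0 // ltW // divr_gt0.
near=> k.
have k0 : (0 < k)%N by near: k; exact: nbhs_infty_gt.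
have dX : X <= nroot k by apply: nroot_ge => //; near: k; exact: nbhs_infty_ger.
have d1 : 1 <= nroot k by apply: nroot_ge => //; rewrite expr1n ler1n.
have d0 := nroot_gt0 k0.
have dnm0 : 0 < nroot k ^+ (n - m) by rewrite exprn_gt0.
rewrite sub0r normrN ger0_norm ?divr_ge0 ?powsum_ge0 ?(ltW dnm0) //.
rewrite ler_pdivrMr //.
have h1 : (L.*2.+1)%:R <= e / 3 * nroot k ^+ (n - m).
  rewrite -ler_pdivrMl ?divr_gt0 // mulrC; apply: le_trans dX _.
  rewrite -[X in X <= _]expr1 ler_weXn2l //; lia.
have [LK|KL] := leqP L (T * k)%N; last first.
  apply: (@le_trans _ _ (powsum m L)).
    by apply: zpartial_nondecreasing (ltnW KL) => l; rewrite exprn_ge0.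
  apply: le_trans (powsum_le_card _ _) _; apply: le_trans h1 _.
  by rewrite ler_wpM2r ?(ltW dnm0) //; lra.
have edk : 0 < eta / nroot k by rewrite divr_gt0.
apply: le_trans (powsum_le edk (ltnW mn) LK) _.
have h2 : (eta / nroot k)^-1 ^+ (n - m) * (powsum n (T * k) - powsum n L)
    <= e / 3 * nroot k ^+ (n - m).
  have -> : e / 3 * nroot k ^+ (n - m) = (eta / nroot k)^-1 ^+ (n - m) * e'.
    rewrite invf_div exprMn exprVn /e'; field.
    by rewrite expf_neq0 // gt_eqF.
  rewrite ler_wpM2l ?exprn_ge0 ?invr_ge0 ?(ltW edk) //.
  have := hL _ LK; congr (_ - _ <= _); apply: eq_bigr => i _;
    by rewrite ger0_norm // exprn_ge0.
have h3 : (eta / nroot k) ^+ m * ((T * k).*2.+1)%:R <= e / 3 * nroot k ^+ (n - m).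
  apply: le_trans (scale_bound k0 (ltnW mn) (ltW eta0)) _.
  by rewrite ler_wpM2r // ltW.
have h4 := le_trans (powsum_le_card m L) h1.
have -> : e * nroot k ^+ (n - m) = e / 3 * nroot k ^+ (n - m) +
  e / 3 * nroot k ^+ (n - m) + e / 3 * nroot k ^+ (n - m) by field.
by rewrite !lerD.
Unshelve. all: by end_near. Qed.

Lemma prod_powsum_cvg0 (ms : seq nat) : all (fun m => m <= n)%N ms ->
  has (fun m => 0 < m < n)%N ms ->
  (fun k => \prod_(m <- ms) (m.+1%:R * powsum m (T * k) / nroot k ^+ (n - m)))
    @ \oo --> (0 : R).
Proof.
move=> msn /hasP[m mms /andP[m0 mn]].
have B0 : 0 <= B by apply: le_trans (rho_bound 0); apply: powsum_ge0.
(* [C] bounds every factor by [powsum_growth]; the factor with [0 < m < n] alone brings the product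
   to [0]. *)
pose C := n.+1%:R * (B + (T.*2.+1)%:R).
pose u k m := m.+1%:R * powsum m (T * k) / nroot k ^+ (n - m).
have u0 k l : 0 <= u k l.
  by rewrite divr_ge0 ?mulr_ge0 ?powsum_ge0 ?exprn_ge0 // powR_ge0.
have uC k l : (0 < k)%N -> (l <= n)%N -> u k l <= C.
  move=> k0 ln; rewrite /u /C -mulrA ler_pM // ?ler_nat //.
    by rewrite divr_ge0 ?powsum_ge0 ?exprn_ge0 ?powR_ge0.
  by rewrite ler_pdivrMr ?exprn_gt0 ?nroot_gt0 // powsum_growth.
have um : (fun k => C ^+ (size (rem m ms)) * u k m) @ \oo --> (0 : R).
  rewrite -[X in _ --> X](mulr0 (C ^+ (size (rem m ms)))); apply: cvgMr.
  rewrite /u -[X in _ --> X](mulr0 m.+1%:R).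
  under eq_fun do rewrite -mulrA.
  by apply: cvgMr; exact: powsum_littleo.
apply: (squeeze_cvgr _ (cvg_cst 0) um); near=> k.
have k0 : (0 < k)%N by near: k; exact: nbhs_infty_gt.
rewrite /=; apply/andP; split.
  by apply: (@prodr_ge0 _ _ ms xpredT (u k)) => i _; exact: u0.
rewrite (big_rem m mms) /= mulrC ler_wpM2r ?u0 //.
have -> : C ^+ size (rem m ms) = \prod_(i <- rem m ms) C.
  by rewrite big_const_seq count_predT -Monoid.iteropE.
rewrite [X in X <= _]big_seq [X in _ <= X]big_seq.
apply: ler_prod => i /mem_rem ims; rewrite -/(u k i).
by rewrite u0 uC // (allP msn).
Unshelve. all: by end_near. Qed.

End Growth.

(** * Irregular monomials *)

Section Degrees.
Variable T : eqType.
Implicit Types (s : seq T) (E : seq (T * T)).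

Definition incident v (e : T * T) := (e.1 == v) || (e.2 == v).
Definition loopless E := all (fun e => e.1 != e.2) E.

(** Degrees at the time of elimination: removing [v] deletes its edges, so each edge is counted
    once, at its endpoint eliminated first. *)
Fixpoint degs s E : seq nat :=
  if s is v :: s' then degree E v :: degs s' [seq e <- E | ~~ incident v e]
  else [::].

Lemma size_degs s E : size (degs s E) = size s.
Proof. by elim: s E => //= v s IH E; rewrite IH. Qed.

Lemma degs_cat s1 s2 E : degs (s1 ++ s2) E =
  degs s1 E ++ degs s2 [seq e <- E | (e.1 \notin s1) && (e.2 \notin s1)].
Proof.
elim: s1 E => [|v s1 IH] E /=; first by rewrite filter_predT.
rewrite IH -filter_predI; congr (_ :: _ ++ degs _ _); apply: eq_filter => e /=.
rewrite !inE /incident !negb_or.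
by case: (e.1 == v); case: (e.2 == v); rewrite /= ?andbF ?andbT.
Qed.

Lemma degs_le n s E : (forall v, degree E v <= n)%N ->
  all (fun m => m <= n)%N (degs s E).
Proof.
elim: s E => //= v s IH E dE; rewrite dE IH // => u; apply: leq_trans (dE u).
by rewrite /degree count_filter; apply: sub_count => e /andP[].
Qed.

Lemma sumn_degs s E : all (fun e => (e.1 \in s) || (e.2 \in s)) E ->
  sumn (degs s E) = size E.
Proof.
elim: s E => [|v s IH] E /=; first by case: E.
move=> cE; rewrite IH ?size_filter; first by rewrite -(count_predC (incident v)).
rewrite all_filter; apply: sub_all cE => e; rewrite !inE /incident negb_or /=.
by case: (e.1 == v); case: (e.2 == v).
Qed.

End Degrees.

Lemma handshake (T : finType) (E : seq (T * T)) : loopless E ->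
  (\sum_v degree E v = (size E).*2)%N.
Proof.
elim: E => [|e E IH] /=; first by rewrite big1.
move=> /andP[ee lE].
rewrite big_split /= (IH lE) doubleS -addn2 addnC; congr (_ + _)%N.
transitivity #|pred2 e.1 e.2|; last by rewrite card2 ee.
rewrite -sum1_card [RHS]big_mkcond; apply: eq_bigr => v _.
by rewrite inE /= ![v == _]eq_sym; case: (_ || _).
Qed.

(** * Summing out the indices of a monomial vertex by vertex *)

Section GraphSum.
Variables (R : realType) (rho : int -> R) (r K : nat).
Hypothesis rho_even : forall l, rho (- l) = rho l.
Hypothesis K0 : (0 < K)%N.
Implicit Types (l : {ffun 'I_r -> 'I_K}) (E : seq ('I_r * 'I_r)).

Definition edgew l (e : 'I_r * 'I_r) : R := `|rho ((l e.1)%:Z - (l e.2)%:Z)|.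

Definition updf l v x : {ffun 'I_r -> 'I_K} := [ffun u => if u == v then x else l u].

(** Swapping [l v] with [x] is an involution on pairs. This allows one index to be summed out
    without changing the type of index families. *)
Lemma sum_updf (F : {ffun 'I_r -> 'I_K} -> R) v :
  \sum_l \sum_(x < K) F (updf l v x) = K%:R * \sum_l F l.
Proof.
rewrite pair_big /=.
pose h (p : {ffun 'I_r -> 'I_K} * 'I_K) := (updf p.1 v p.2, p.1 v).
have hK : involutive h.
  move=> [l x]; rewrite /h /= !ffunE eqxx; congr (_, _).
  by apply/ffunP => u; rewrite !ffunE; case: eqP => // ->.
rewrite (reindex_inj (can_inj hK)) /=.
transitivity (\sum_(p : {ffun 'I_r -> 'I_K} * 'I_K) F p.1).
  by apply: eq_bigr => p _; rewrite -[in RHS](hK p).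
rewrite -(pair_big xpredT xpredT (fun l _ => F l)) /= mulr_sumr.
by apply: eq_bigr => l _; rewrite sumr_const card_ord mulr_natl.
Qed.

(** The successor in [(size F).+1] accounts for an isolated vertex, whose [K] choices are at most
    [powsum rho 0 K]. *)
Lemma row_bound (F : seq 'I_r) l :
  \sum_(x < K) \prod_(u <- F) `|rho (x%:Z - (l u)%:Z)| <=
  (size F).+1%:R * powsum rho (size F) K.
Proof.
apply: (@le_trans _ _ (\sum_(x < K) (\sum_(u <- F) `|rho (x%:Z - (l u)%:Z)| ^+ size F
   + (F == [::])%:R))).
  by apply: ler_sum => x _; apply: prod_le_sum_expr.
rewrite big_split /= -natr1 mulrDl mul1r lerD //.
  rewrite exchange_big /= -[X in X%:R]count_predT -sum1_count natr_sum mulr_suml.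
  apply: ler_sum => u _; rewrite mul1r.
  rewrite -(big_mkord xpredT (fun x => `|rho (x%:Z - (l u)%:Z)| ^+ size F)).
  apply: (@sum_shift_le _ (fun d => `|rho d| ^+ size F)) => //.
    by move=> d; rewrite exprn_ge0.
  by apply: ltnW.
rewrite sumr_const card_ord; case: eqP => [->|_]; last first.
  by rewrite mul0rn powsum_ge0.
by rewrite /powsum zpartial_cst mul1r ler_nat; lia.
Qed.

(** The division by [K] compensates for the index of [v], which remains in the sum as a free
    variable. *)
Lemma vertex_bound E v : loopless E ->
  \sum_l \prod_(e <- E) edgew l e <=
  (degree E v).+1%:R * powsum rho (degree E v) K / K%:R *
    \sum_l \prod_(e <- E | ~~ incident v e) edgew l e.
Proof.
move=> lE; have K0R : 0 < K%:R :> R by rewrite ltr0n.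
rewrite -(ler_pM2l K0R) -(sum_updf _ v) mulrA mulrCA mulfV ?gt_eqF // mulr1.
rewrite mulr_sumr; apply: ler_sum => l _.
pose F := [seq (if e.1 == v then e.2 else e.1) | e <- E & incident v e].
have sF : size F = degree E v by rewrite size_map size_filter.
rewrite -sF; apply: le_trans (ler_wpM2r _ (row_bound F l)); last first.
  by apply: prodr_ge0 => e _; exact: normr_ge0.
rewrite mulr_suml le_eqVlt; apply/orP; left; apply/eqP; apply: eq_bigr => x _.
rewrite (bigID (incident v)) /= big_map big_filter; congr (_ * _).
  rewrite big_seq_cond [RHS]big_seq_cond; apply: eq_bigr => e.
  move=> /andP[/(allP lE) /negbTE ee]; rewrite /incident /edgew !ffunE.
  case: eqP => [e1 _|_ /= /eqP e2].
    by rewrite eq_sym -e1 ee.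
  by rewrite e2 eqxx -rho_even opprB.
apply: eq_bigr => e; rewrite /incident negb_or /edgew !ffunE.
by case/andP=> /negbTE-> /negbTE->.
Qed.

Lemma graph_bound s E : loopless E ->
  all (fun e => (e.1 \in s) || (e.2 \in s)) E ->
  \sum_l \prod_(e <- E) edgew l e <=
  K%:R ^+ r * \prod_(m <- degs s E) (m.+1%:R * powsum rho m K / K%:R).
Proof.
elim: s E => [|v s IH] E lE cE /=.
  case: E cE {lE} => // _; rewrite big_nil mulr1.
  under eq_bigr do rewrite big_nil.
  by rewrite sumr_const card_ffun !card_ord natrX.
apply: le_trans (vertex_bound v lE) _; rewrite big_cons mulrCA.
rewrite ler_wpM2l ?divr_ge0 ?mulr_ge0 ?powsum_ge0 //.
rewrite (eq_bigr (fun l => \prod_(e <- [seq e <- E | ~~ incident v e]) edgew l e));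
  last by move=> l _; rewrite big_filter.
apply: IH.
  by rewrite /loopless all_filter; apply: sub_all lE => e /= ->; rewrite implybT.
rewrite all_filter; apply: sub_all cE => e; rewrite !inE /incident negb_or /=.
by case: (e.1 == v); case: (e.2 == v).
Qed.

End GraphSum.

Section Irregular.
Variables (R : realType) (rho : int -> R) (n r : nat) (B : R).
Hypothesis n0 : (0 < n)%N.
Hypothesis rho_le1 : forall l, `|rho l| <= 1.
Hypothesis rho_even : forall l, rho (- l) = rho l.
Hypothesis rho_summable : abs_summable_Z (fun l => `|rho l| ^+ n).
Hypothesis rho_bound : forall K, zpartial (fun l => `|rho l| ^+ n) K <= B.

(* Eliminating first the vertices outside [P], then [v], then those of [P],
   the vertex [v] is eliminated with a degree strictly between [0] and [n]. *)
Lemma irregular_degs (E : seq ('I_r * 'I_r)) :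
  completes n [::] (enum 'I_r) E -> irregular n (enum 'I_r) E ->
  exists s, [/\ size s = r, forall v, v \in s &
     has (fun m => 0 < m < n)%N (degs s E)].
Proof.
move=> [h1 h2 _] [v [P [_ vP dv]]].
pose s1 := [seq u <- enum 'I_r | (u \notin P) && (u != v)].
pose s2 := [seq u <- enum 'I_r | u \in P].
have me u : u \in enum 'I_r by rewrite mem_enum.
have ms1 u : (u \in s1) = (u \notin P) && (u != v).
  by rewrite mem_filter me andbT.
have ms2 u : (u \in s2) = (u \in P) by rewrite mem_filter me andbT.
have mems u : u \in s1 ++ v :: s2.
  rewrite mem_cat inE ms1 ms2.
  by case: (u \in P); case: (u == v).
exists (s1 ++ v :: s2); split=> //.
  rewrite -[RHS](size_enum_ord r); apply/perm_size/uniq_perm; last 1 first.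
  - by move=> u; rewrite mems me.
  - have us1 : uniq s1 by exact: filter_uniq (enum_uniq _).
    have us2 : uniq s2 by exact: filter_uniq (enum_uniq _).
    rewrite cat_uniq cons_uniq us1 us2 ms2 vP andbT.
    rewrite [has _ _]/= negb_or ms1 eqxx andbF /= ?andbT.
    by apply/hasPn => u; rewrite ms2 /= ms1 => ->.
  exact: enum_uniq.
rewrite degs_cat has_cat /=; apply/or3P; constructor 2.
set d := degree _ _; suff -> : d = degree_to E v P by [].
rewrite /d /degree count_filter; apply: eq_in_count => e /(allP h1) /andP[_ ee] /=.
rewrite !ms1 !negb_and !negbK.
have [e1|e1] := eqVneq e.1 v; have [e2|e2] := eqVneq e.2 v.
- by rewrite e1 e2 eqxx in ee.
- by rewrite /= e1 (negbTE vP) orbF.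
- by rewrite /= e2 (negbTE vP) /= ?orbT ?orbF ?andbT.
by [].
Qed.

Lemma nroot_sqrt k : (0 < k)%N -> forall a, (n * r = a.*2)%N ->
  nroot R n k ^+ a = Num.sqrt k%:R ^+ r.
Proof.
move=> k0 a ea; apply/eqP.
rewrite -(@eqrXn2 _ 2) ?exprn_ge0 ?sqrtr_ge0 ?powR_ge0 //.
by rewrite -!exprM muln2 -ea exprM nrootX // mulnC exprM sqr_sqrtr.
Qed.

Theorem irregular_cvg0 (T : nat) (E : seq ('I_r * 'I_r)) :
  (0 < T)%N -> completes n [::] (enum 'I_r) E -> irregular n (enum 'I_r) E ->
  (fun k => (Num.sqrt k%:R)^-1 ^+ r *
     \sum_(l : {ffun 'I_r -> 'I_(T * k)}) \prod_(e <- E) edgew rho l e)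
    @ \oo --> (0 : R).
Proof.
move=> T0 cE iE; have [s [sr sall hs]] := irregular_degs cE iE.
have [h1 h2 _] := cE.
have lE : loopless E by apply: sub_all h1 => e /andP[].
have dn v : degree E v = n by rewrite h2 // mem_enum.
have cs : all (fun e => (e.1 \in s) || (e.2 \in s)) E.
  by apply/allP => e _; rewrite sall.
have nr : (n * r = (size E).*2)%N.
  rewrite -handshake //; under eq_bigr do rewrite dn.
  by rewrite sum_nat_const card_ord mulnC.
have msn : all (fun m => m <= n)%N (degs s E) by apply: degs_le => v; rewrite dn.
have lim := prod_powsum_cvg0 n0 rho_le1 rho_summable rho_bound T msn hs.
apply: (squeeze_cvgr _ (cvg_cst 0) lim); near=> k.
have k0 : (0 < k)%N by near: k; exact: nbhs_infty_gt.
have k0R : 0 < k%:R :> R by rewrite ltr0n.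
have sk0 : 0 < Num.sqrt k%:R ^+ r :> R by rewrite exprn_gt0 // sqrtr_gt0.
rewrite /= exprVn; apply/andP; split.
  rewrite mulr_ge0 ?invr_ge0 ?(ltW sk0) // sumr_ge0 // => l _.
  by apply: prodr_ge0 => e _; exact: normr_ge0.
rewrite mulrC ler_pdivrMr //.
have Tk0 : (0 < T * k)%N by rewrite muln_gt0 T0.
apply: le_trans (graph_bound rho_even Tk0 lE cs) _.
have prodV (c : R) (ms : seq nat) : \prod_(m <- ms) c = c ^+ size ms.
  by rewrite big_const_seq count_predT -Monoid.iteropE.
rewrite big_split /= prodV size_degs sr exprVn mulrC mulfVK; last first.
  by rewrite expf_neq0 // pnatr_eq0 -lt0n.
rewrite [X in _ <= X * _]big_split /= le_eqVlt; apply/orP; left; apply/eqP.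
rewrite -mulrA -[LHS]mulr1; congr (_ * _).
have dk0 := nroot_gt0 R n k0.
(* The degrees at elimination add up to [size E] and [n * r] is twice that, so the gaps [n - m] also
   add up to [size E]: the denominators multiply to exactly the normalisation. *)
have -> : Num.sqrt k%:R ^+ r = \prod_(m <- degs s E) nroot R n k ^+ (n - m).
  rewrite -(nroot_sqrt k0 nr) -(sumn_degs cs).
  have : sumn (degs s E) = (\sum_(m <- degs s E) (n - m))%N.
    have : (sumn (degs s E) + \sum_(m <- degs s E) (n - m) = (size E).*2)%N.
      have sd : size (degs s E) = r by rewrite size_degs.
      rewrite -nr -[X in (n * X)%N]sd.
      elim: (degs s E) msn => [|m ms IH] /=; first by rewrite big_nil muln0.
      by move=> /andP[mn /IH e]; rewrite big_cons; nia.
    by rewrite (sumn_degs cs) -addnn => /addnI.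
  move=> ->; elim: (degs s E) => [|m ms IH]; first by rewrite !big_nil.
  by rewrite !big_cons exprD IH.
rewrite -big_split /= big1 // => m _; rewrite mulVf // expf_neq0 // gt_eqF //.
Unshelve. all: by end_near. Qed.

End Irregular.

(** * The limit of the block sums *)

Section FiniteCvg.
Variables (R : realType) (I : Type) (s : seq I) (P : pred I).
Variables (F : I -> nat -> R) (l : I -> R).
Hypothesis Fl : forall i, P i -> F i @ \oo --> l i.

Lemma cvg_sumR :
  (fun k => \sum_(i <- s | P i) F i k) @ \oo --> \sum_(i <- s | P i) l i.
Proof. by apply: cvg_big => //; exact: add_continuous. Qed.

Lemma cvg_prodR :
  (fun k => \prod_(i <- s | P i) F i k) @ \oo --> \prod_(i <- s | P i) l i.
Proof. by apply: cvg_big => //; exact: mul_continuous. Qed.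

End FiniteCvg.

Lemma cvg_sum_seq0 (R : realType) (I : eqType) (s : seq I) (F : I -> nat -> R) :
  (forall i, i \in s -> F i @ \oo --> (0 : R)) ->
  (fun k => \sum_(i <- s) F i k) @ \oo --> (0 : R).
Proof.
elim: s => [|i s IH] Fs.
  have -> : (fun k => \sum_(i <- [::]) F i k) = (fun=> 0 : R).
    by apply/funext => k; rewrite big_nil.
  exact: cvg_cst.
have -> : (fun k => \sum_(j <- i :: s) F j k) = (F i \+ (fun k => \sum_(j <- s) F j k)).
  by apply/funext => k; rewrite big_cons.
rewrite -[X in _ --> X]addr0; apply: cvgD; first by apply: Fs; rewrite mem_head.
by apply: IH => j js; apply: Fs; rewrite inE js orbT.
Qed.

(** * Sums over index families that factor along a pairing *)

Section Pairing.
Variables (R : realType) (r : nat) (f : {ffun 'I_r -> 'I_r}).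
Hypothesis pf : is_pairing f.

Lemma pairingK : involutive f.
Proof. by move=> x; have /forallP/(_ x)/andP[/eqP] := pf. Qed.

Lemma pairing_ltN (x : 'I_r) : (x < f x)%N = ~~ (f x < x)%N.
Proof.
have /forallP/(_ x)/andP[_ fx] := pf.
by rewrite -leqNgt [in RHS]leq_eqVlt; case: eqP => // /val_inj e; rewrite -e eqxx in fx.
Qed.

Lemma prod_pairing (F : 'I_r -> R) :
  \prod_i F i = \prod_(a : 'I_r | (a < f a)%N) (F a * F (f a)).
Proof.
rewrite big_split /= (bigID (fun a : 'I_r => (a < f a)%N)) /=; congr (_ * _).
rewrite (reindex_inj (can_inj pairingK)) /=; apply: eq_bigl => a.
by rewrite pairingK -pairing_ltN.
Qed.

Lemma sum_prod_pairing K (g : 'I_r -> 'I_K -> 'I_K -> R) : (0 < K)%N ->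
  \sum_(l : {ffun 'I_r -> 'I_K}) \prod_(a : 'I_r | (a < f a)%N) g a (l a) (l (f a)) =
  \prod_(a : 'I_r | (a < f a)%N) \sum_(x < K) \sum_(y < K) g a x y.
Proof.
move=> K0; pose p0 : 'I_K * 'I_K := (Ordinal K0, Ordinal K0).
under [RHS]eq_bigr do rewrite pair_big /=.
rewrite (big_distr_big p0) /=.
(* A family of indices is read as the choice of two indices at each left end of a pair; right ends
   receive the default [p0], as the distributivity law prescribes. *)
pose h (l : {ffun 'I_r -> 'I_K}) : {ffun 'I_r -> 'I_K * 'I_K} :=
  [ffun a : 'I_r => if (a < f a)%N then (l a, l (f a)) else p0].
pose h' (P : {ffun 'I_r -> 'I_K * 'I_K}) : {ffun 'I_r -> 'I_K} :=
  [ffun a : 'I_r => if (a < f a)%N then (P a).1 else (P (f a)).2].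
rewrite (reindex_onto h h') /=; last first.
  move=> P /pffun_onP[/supportP sP _]; apply/ffunP => a.
  rewrite !ffunE pairingK; case: ifP => af; last by rewrite sP //= unfold_in af.
  have /negbTE-> : ~~ (f a < a)%N by rewrite -pairing_ltN.
  by rewrite af; case: (P a).
apply: eq_big => [l|l _]; last first.
  by apply: eq_bigr => a af; rewrite ffunE af.
apply/esym/andP; split; last first.
  apply/eqP/ffunP => a; rewrite !ffunE pairingK; case: (boolP (a < f a)%N) => //= af.
  by have -> : (f a < a)%N by apply: negbNE; rewrite -pairing_ltN.
by apply/pffun_onP; split=> //; apply/supportP => a; rewrite ffunE unfold_in => /negbTE->.
Qed.

Lemma sum_box_pairing K (N : 'I_r -> nat) (h : nat -> nat -> R) : (0 < K)%N ->
  (forall i, N i <= K)%N ->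
  \sum_(l : {ffun 'I_r -> 'I_K} | [forall i, (l i < N i)%N])
     \prod_(a : 'I_r | (a < f a)%N) h (l a) (l (f a)) =
  \prod_(a : 'I_r | (a < f a)%N)
     \sum_(0 <= x < N a) \sum_(0 <= y < N (f a)) h x y.
Proof.
move=> K0 NK.
(* Each point lies in exactly one pair, so the box condition splits over the pairs and can be
   encoded by zero values. *)
pose g a (x y : 'I_K) := if (x < N a)%N && (y < N (f a))%N then h x y else 0.
transitivity (\prod_(a : 'I_r | (a < f a)%N) \sum_(x < K) \sum_(y < K) g a x y).
  rewrite -sum_prod_pairing // big_mkcond /=; apply: eq_bigr => l _.
  case: forallP => [lN|/forallP/forallPn[i iN]].
    by apply: eq_bigr => a _; rewrite /g !lN.
  apply/esym/eqP/prodf_eq0.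
  have := pairing_ltN i; case: (boolP (i < f i)%N) => [ifi _|_ /esym/negbFE fii].
    by exists i => //; rewrite /g (negbTE iN).
  by exists (f i); rewrite pairingK // /g pairingK (negbTE iN) andbF.
apply: eq_bigr => a _; rewrite [RHS]big_mkord.
rewrite (big_ord_widen _ (fun x => \sum_(0 <= y < N (f a)) h x y) (NK a)).
rewrite [RHS]big_mkcond /=.
apply: eq_bigr => x _; rewrite /g; case: (x < N a)%N => /=; last by rewrite big1.
by rewrite big_mkord (big_ord_widen _ (h x) (NK (f a))) [RHS]big_mkcond.
Qed.

End Pairing.

Section Limit.
Variables (R : realType) (rho : int -> R) (n r : nat) (q : R) (t : 'I_r -> R).
Hypothesis n0 : (0 < n)%N.
Hypothesis rho_le1 : forall l, `|rho l| <= 1.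
Hypothesis rho_even : forall l, rho (- l) = rho l.
Hypothesis rho_summable : abs_summable_Z (fun l => `|rho l| ^+ n).
Hypothesis t0 : forall i, 0 <= t i.
Variable T : nat.
Hypothesis T0 : (0 < T)%N.
Hypothesis tT : forall k i, (0 < k)%N -> (npts k (t i) <= T * k)%N.

(** Different times give ranges of different lengths; a common type cut down by a box lets the
    bounds for graph sums apply to all of them. *)
Definition inbox k (l : {ffun 'I_r -> 'I_(T * k)}) :=
  [forall i, (l i < npts k (t i))%N].

Definition labcov k (l : {ffun 'I_r -> 'I_(T * k)}) (i j : 'I_r) : R :=
  rho ((l i)%:Z - (l j)%:Z).

Let summable_pow : abs_summable_Z (fun l => rho l ^+ n).
Proof.
have [M hM] := rho_summable; exists M => N; apply: le_trans (hM N).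
by apply: ler_sum => i _; rewrite !normrX normr_id.
Qed.

Lemma pairing_cvg (c : R) f : is_pairing f ->
  (fun k => (Num.sqrt k%:R)^-1 ^+ r *
     \sum_(l : {ffun 'I_r -> 'I_(T * k)} | inbox l)
       \prod_(a : 'I_r | (a < f a)%N) (c * labcov l a (f a) ^+ n)) @ \oo -->
  \prod_(a : 'I_r | (a < f a)%N)
     (c * zsum (fun l => rho l ^+ n) * Num.min (t a) (t (f a))).
Proof.
(* The shift discards [k = 0], where [npts] is [1] but [T * k] is [0]. *)
move=> pf; rewrite -cvg_shiftS /=.
pose u (a : 'I_r) k := c * (k%:R^-1 * \sum_(0 <= x < npts k (t a))
   \sum_(0 <= y < npts k (t (f a))) rho (x%:Z - y%:Z) ^+ n).
have -> : (fun k => (Num.sqrt k.+1%:R)^-1 ^+ r *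
     \sum_(l : {ffun 'I_r -> 'I_(T * k.+1)} | inbox l)
       \prod_(a : 'I_r | (a < f a)%N) (c * labcov l a (f a) ^+ n)) =
   (fun k => \prod_(a : 'I_r | (a < f a)%N) u a k.+1).
  apply/funext => k; rewrite (sum_box_pairing pf
    (fun x y => c * rho (x%:Z - y%:Z) ^+ n)) ?muln_gt0 ?T0 //; last first.
    by move=> i; apply: tT.
  (* Each pair receives two inverse square roots, which form the [k^-1] of [pair_sum_cvg]. *)
  have -> : (Num.sqrt k.+1%:R)^-1 ^+ r =
      \prod_(a : 'I_r | (a < f a)%N) k.+1%:R^-1 :> R.
    rewrite -[X in _ ^+ X]card_ord -prodr_const (prod_pairing pf).
    by apply: eq_bigr => a _; rewrite -invfM -expr2 sqr_sqrtr.
  rewrite -big_split /=; apply: eq_bigr => a _; rewrite /u mulrCA; congr (_ * _).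
  by rewrite mulr_sumr; apply: eq_bigr => x _; rewrite mulr_sumr.
rewrite (cvg_shiftS (fun k => \prod_(a : 'I_r | (a < f a)%N) u a k)).
apply: cvg_prodR => a _; rewrite /u -mulrA; apply: cvgMr.
have := @pair_sum_cvg _ (fun l => rho l ^+ n) _ (t a) (t (f a)) summable_pow.
by apply=> // l; rewrite rho_even.
Qed.

Lemma irregular_sum_cvg (E : seq ('I_r * 'I_r)) :
  completes n [::] (enum 'I_r) E -> irregular n (enum 'I_r) E ->
  (fun k => (Num.sqrt k%:R)^-1 ^+ r *
     \sum_(l : {ffun 'I_r -> 'I_(T * k)} | inbox l) edgeprod (labcov l) E)
    @ \oo --> (0 : R).
Proof.
move=> cE iE; have [B hB] := rho_summable.
have hB' K : zpartial (fun l => `|rho l| ^+ n) K <= B.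
  by apply: le_trans (hB K); apply: ler_sum => i _; exact: ler_norm.
have lim := irregular_cvg0 n0 rho_le1 rho_even rho_summable hB' T0 cE iE.
apply/norm_cvg0P; apply: (squeeze_cvgr _ (cvg_cst 0) lim); near=> k.
rewrite /= normr_ge0 /= normrM ger0_norm; last by rewrite exprn_ge0 // invr_ge0 sqrtr_ge0.
rewrite ler_wpM2l ?exprn_ge0 ?invr_ge0 ?sqrtr_ge0 //.
apply: le_trans (ler_norm_sum _ _ _) _.
rewrite big_mkcond /=; apply: ler_sum => l _; case: ifP => _.
  by rewrite /edgeprod normr_prod.
by apply: prodr_ge0 => e _; exact: normr_ge0.
Unshelve. all: by end_near. Qed.

Theorem blockfock_cvg :
  (fun k => (Num.sqrt k%:R)^-1 ^+ r *
     \sum_(l : {ffun 'I_r -> 'I_(T * k)} | inbox l)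
        blockfock q (labcov l) n (enum 'I_r) [::]) @ \oo -->
  wick (q ^+ (n ^ 2)) (fun a b =>
     qfact q n * zsum (fun l => rho l ^+ n) * Num.min (t a) (t b)).
Proof.
have [|||L [LP LE]] := @blockfock_regular R 'I_r q n (enum 'I_r) [::] n0.
- exact: enum_uniq.
- by [].
- by [].
pose c := qfact q n.
have -> : (fun k => (Num.sqrt k%:R)^-1 ^+ r *
     \sum_(l : {ffun 'I_r -> 'I_(T * k)} | inbox l)
        blockfock q (labcov l) n (enum 'I_r) [::]) =
  (fun k => \sum_(f : {ffun 'I_r -> 'I_r} | is_pairing f)
     q ^+ (n ^ 2) ^+ crossings f * ((Num.sqrt k%:R)^-1 ^+ r *
     \sum_(l : {ffun 'I_r -> 'I_(T * k)} | inbox l)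
       \prod_(a : 'I_r | (a < f a)%N) (c * labcov l a (f a) ^+ n))
   + \sum_(p <- L) p.1 * ((Num.sqrt k%:R)^-1 ^+ r *
     \sum_(l : {ffun 'I_r -> 'I_(T * k)} | inbox l) edgeprod (labcov l) p.2)).
  apply/funext => k.
  under eq_bigr => l _.
    have -> : blockfock q (labcov l) n (enum 'I_r) [::] =
      wick (q ^+ (n ^ 2)) (fun a b => c * labcov l a b ^+ n)
      + \sum_(p <- L) p.1 * edgeprod (labcov l) p.2.
      rewrite -LE (wick_fock _ id (fun a b => c * labcov l a b ^+ n)) map_id.
      by rewrite [RHS]addrC subrK.
    over.
  rewrite big_split mulrDr /=; congr (_ + _).
    rewrite exchange_big mulr_sumr /=; apply: eq_bigr => f _.
    by rewrite -mulr_sumr mulrCA.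
  rewrite exchange_big mulr_sumr /=; apply: eq_bigr => p _.
  by rewrite -mulr_sumr mulrCA.
rewrite -[X in _ --> X]addr0; apply: cvgD.
  apply: cvg_sumR => f pf; apply: cvgMr; exact: pairing_cvg.
apply: cvg_sum_seq0 => p /LP[cE iE].
by rewrite -[X in _ --> X](mulr0 p.1); apply: cvgMr; exact: irregular_sum_cvg.
Qed.

End Limit.

(** * Moments of the normalised sums *)

Lemma prod_scale (K : comNzRingType) (A : algType K) I (w : seq I) (c : K) (F : I -> A) :
  \prod_(i <- w) (c *: F i) = c ^+ size w *: \prod_(i <- w) F i.
Proof.
elim: w => [|i w IH] /=; first by rewrite !big_nil scale1r.
by rewrite !big_cons IH -scalerAl -scalerAr scalerA exprS.
Qed.

Lemma prod_enum (A : pzRingType) r (F : 'I_r -> A) :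
  \prod_(i < r) F i = \prod_(i <- enum 'I_r) F i.
Proof. by rewrite enumT. Qed.

Lemma prod_scale_ord (K : comNzRingType) (A : algType K) r (c : K) (F : 'I_r -> A) :
  \prod_(i < r) (c *: F i) = c ^+ r *: \prod_(i < r) F i.
Proof.
by rewrite !prod_enum prod_scale size_enum_ord.
Qed.

Section Wstar.
Variables (R : realType) (A : algType R[i]) (star : A -> A) (phi : A -> R[i]).
Hypothesis W : is_Wstar_prob_space star phi.

Lemma phiL (a : R[i]) (x y : A) : phi (a *: x + y) = a * phi x + phi y.
Proof. by case: W => _ _ _ _ [h]. Qed.

Lemma phi0 : phi 0 = 0.
Proof. by have := phiL (-1) 0 0; rewrite scaler0 addr0 mulN1r addNr. Qed.

Lemma phiD x y : phi (x + y) = phi x + phi y.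
Proof. by have := phiL 1 x y; rewrite scale1r mul1r. Qed.

Lemma phiZ a x : phi (a *: x) = a * phi x.
Proof. by have := phiL a x 0; rewrite !addr0 phi0 addr0. Qed.

Lemma phi_sum I (s : seq I) (P : pred I) (F : I -> A) :
  phi (\sum_(i <- s | P i) F i) = \sum_(i <- s | P i) phi (F i).
Proof. exact: (big_morph phi phiD phi0). Qed.

Lemma phi1 : phi 1 = 1. Proof. by case: W => _ _ _ _ []. Qed.
Lemma phi_tracial x y : phi (x * y) = phi (y * x).
Proof. by case: W => _ _ _ _ []. Qed.
Lemma phi_ge0 x : star x = x -> 0 <= phi (x * x).
Proof. by move=> e; case: W => _ _ _ _ [_ _ /(_ x)]; rewrite e. Qed.

Lemma starD x y : star (x + y) = star x + star y. Proof. by case: W. Qed.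
Lemma starM x y : star (x * y) = star y * star x. Proof. by case: W. Qed.
Lemma starK x : star (star x) = x. Proof. by case: W. Qed.

Lemma starZ (a : R) x : star (a%:C *: x) = a%:C *: star x.
Proof. by case: W => _ -> _ _ _; rewrite conjc_real. Qed.

Lemma star0 : star 0 = 0.
Proof. by apply: (addrI (star 0)); rewrite -starD !addr0. Qed.

Lemma star1 : star 1 = 1.
Proof. by rewrite -[LHS]mul1r -{1}(starK 1) -starM mul1r starK. Qed.

Lemma star_sum I (s : seq I) (P : pred I) (F : I -> A) :
  star (\sum_(i <- s | P i) F i) = \sum_(i <- s | P i) star (F i).
Proof. exact: (big_morph star starD star0). Qed.

Lemma star_peval p x : star x = x -> star (peval p x) = peval p x.
Proof.
move=> e; rewrite /peval star_sum; apply: eq_bigr => i _; rewrite starZ.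
congr (_ *: _); elim: (nat_of_ord i) => [|j IH]; first by rewrite expr0 star1.
by rewrite {1}exprS starM IH e exprSr.
Qed.

Lemma star_Yproc q n (G : nat -> A) k t : (forall l, star (G l) = G l) ->
  star (Yproc q n G k t) = Yproc q n G k t.
Proof.
move=> e; rewrite /Yproc starZ star_sum; congr (_ *: _).
by apply: eq_bigr => l _; rewrite star_peval.
Qed.

Variables (q : R) (rho : int -> R) (G : nat -> A).
Hypothesis GG : is_qGaussian_stationary phi G q rho.
Hypothesis Gstar : forall l, star (G l) = G l.

Lemma phi_word (T : Type) (lab : T -> nat) (u : seq T) :
  phi (\prod_(x <- u) G (lab x)) =
  (fock q (fun x y => rho ((lab x)%:Z - (lab y)%:Z)) u [::])%:C.
Proof.
case: u => [|x0 u0]; first by rewrite big_nil phi1.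
set u := x0 :: u0; rewrite big_tnth.
have := @GG (size u) isT (fun i => lab (tnth (in_tuple u) i)) => ->.
rewrite (wick_fock _ (tnth (in_tuple u)) (fun x y => rho ((lab x)%:Z - (lab y)%:Z))).
by rewrite map_tnth_enum.
Qed.

Lemma phi_pair a b : phi (G a * G b) = (rho (a%:Z - b%:Z))%:C.
Proof.
have := phi_word id [:: a; b]; rewrite !big_cons big_nil mulr1 => ->.
by congr (_%:C); rewrite /= /qfield /= /vac /=; ring.
Qed.

Lemma rho_even l : rho (- l) = rho l.
Proof.
have H (a b : nat) : rho (a%:Z - b%:Z) = rho (b%:Z - a%:Z).
  by apply: complexI; rewrite -!phi_pair phi_tracial.
case: l => m; first by have := H 0 m; rewrite sub0r subr0.
by rewrite NegzE opprK; have := H m.+1 0; rewrite subr0 sub0r.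
Qed.

Hypothesis rho0 : rho 0 = 1.

(** The Cauchy-Schwarz bound, from positivity of [phi] on the squares of [G m + G 0] and
    [G m - G 0]. *)
Lemma rho_le1 l : `|rho l| <= 1.
Proof.
have H (s : R) (m : nat) : s ^+ 2 = 1 -> 0 <= 1 + s * rho m%:Z.
  move=> s2; have : 0 <= phi ((G m + s%:C *: G 0) * (G m + s%:C *: G 0)).
    by apply: phi_ge0; rewrite starD starZ !Gstar.
  rewrite mulrDl !mulrDr -!scalerAl -!scalerAr !scalerA !phiD !phiZ !phi_pair.
  rewrite !subrr !subr0 sub0r rho_even rho0 -!rmorphM -!rmorphD lecR -expr2 s2.
  by rewrite mulr1; lra.
have B (m : nat) : `|rho m%:Z| <= 1.
  have h1 := H 1 m (expr1n _ 2).
  have h2 : 0 <= 1 + -1 * rho m%:Z by apply: H; rewrite sqrrN expr1n.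
  by rewrite ler_norml; lra.
by case: l => m; rewrite ?NegzE ?rho_even.
Qed.

Lemma phi_Yproc n (r T k : nat) (t : 'I_r -> R) : 
  (forall i, npts k (t i) <= T * k)%N ->
  phi (\prod_(i < r) Yproc q n G k (t i)) =
  ((Num.sqrt k%:R)^-1 ^+ r *
     \sum_(l : {ffun 'I_r -> 'I_(T * k)} | inbox t l)
        blockfock q (labcov rho l) n (enum 'I_r) [::])%:C.
Proof.
move=> tT; rewrite prod_scale_ord phiZ rmorphM rmorphXn; congr (_ * _).
under eq_bigr => i _.
  rewrite big_mkord (big_ord_widen _ (fun l => peval (qHermite q n) (G l)) (tT i)).
  over.
rewrite (bigA_distr_big_dep _ (fun i (l : 'I_(T * k)) => peval (qHermite q n) (G l))) /=.
rewrite phi_sum rmorph_sum /=; apply: eq_big => [l|l _].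
  by apply/familyP/forallP => h i; have := h i.
rewrite prod_enum.
apply: (phi_qHermite phiL (Z := fun i => G (l i))) => [i|u].
  by rewrite /labcov subrr rho0.
exact: phi_word.
Qed.

End Wstar.

Lemma npts_uniform_bound (R : realType) r (t : 'I_r -> R) : (forall i, 0 <= t i) ->
  exists T, (0 < T)%N /\ forall k i, (0 < k)%N -> (npts k (t i) <= T * k)%N.
Proof.
move=> t0; exists (\sum_i (Num.truncn (t i)).+1).+2; split=> // k i k0.
have k0R : 0 < k%:R :> R by rewrite ltr0n.
have /andP[_ h1] := npts_bounds k (t0 i).
have /andP[_ h2] := truncn_itv (t0 i).
rewrite -(ler_nat R); apply: le_trans h1 _.
have h3 : ((Num.truncn (t i)).+1 <= \sum_i (Num.truncn (t i)).+1)%N.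
  by rewrite (bigD1 i) //= leq_addr.
have h4 : ((Num.truncn (t i)).+1 * k + 1 <= (\sum_i (Num.truncn (t i)).+1).+2 * k)%N.
  by nia.
apply: le_trans (_ : ((Num.truncn (t i)).+1 * k + 1)%:R <= _); last by rewrite ler_nat.
by rewrite natrD natrM lerD2r mulrC ler_wpM2r // ltW.
Qed.

Lemma wick_const (R : realType) (q x : R) : wick q (fun _ _ : 'I_2 => x) = x.
Proof.
rewrite (wick_fock q (fun=> tt) (fun _ _ => x)).
case: (enum 'I_2) (size_enum_ord 2) => [|a [|b [|]]] // _.
by rewrite /= /qfield /= /vac /=; ring.
Qed.

(** Each pair absorbs two of the [r] factors [c]; for odd [r] both sides are empty sums. *)
Lemma wick_scale (R : realType) r (q c : R) (d : 'I_r -> 'I_r -> R) :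
  c ^+ r * wick q d = wick q (fun a b => c ^+ 2 * d a b).
Proof.
rewrite /wick mulr_sumr; apply: eq_bigr => f pf; rewrite mulrCA; congr (_ * _).
rewrite big_split /=; congr (_ * _).
rewrite -[in LHS](card_ord r) -prodr_const (prod_pairing pf).
by apply: eq_bigr.
Qed.

Theorem theorem1p9 (R : realType) (q : R) (n : nat)
  (A : algType R[i]) (star : A -> A) (phi : A -> R[i])
  (G : nat -> A) (rho : int -> R) :
  0 <= q <= 1 -> (1 <= n)%N ->
  is_Wstar_prob_space star phi ->
  (forall l, star (G l) = G l) ->
  is_qGaussian_stationary phi G q rho ->
  rho 0 = 1 ->
  abs_summable_Z (fun l => `|rho l| ^+ n) ->
  forall (B : algType R[i]) (starB : B -> B) (psi : B -> R[i]) (X : R -> B),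
  is_Wstar_prob_space starB psi ->
  (forall t, starB (X t) = X t) ->
  is_qBrownian_motion psi X (q ^+ (n ^ 2)) ->
  let c : R := Num.sqrt ((\sum_(s : 'S_n) q ^+ inv_count s) *
                         zsum (fun l => rho l ^+ n)) in
  forall (r : nat) (t : 'I_r -> R), (forall i, 0 <= t i) ->
    cvgC (fun k => phi (\prod_(i < r) Yproc q n G k (t i)))
         (psi (\prod_(i < r) (c%:C *: X (t i)))).
Proof.
move=> q01 n0 W Gstar GG rho0 sr B starB psi X WB Xstar XB c r t t0.
have even := rho_even W GG; have le1 := rho_le1 W GG Gstar rho0.
pose z := zsum (fun l => rho l ^+ n).
(* [Num.sqrt] squares back only on nonnegative numbers, and [rho l ^+ n] may be negative for odd
   [n]. The sign is that of a limit of second moments at time [1], each nonnegative since [Yproc] is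
   self-adjoint. *)
have z0 : 0 <= qfact q n * z.
  have o0 (i : 'I_2) : 0 <= (1 : R) by [].
  have [T [T0 tT]] := npts_uniform_bound o0.
  have := @blockfock_cvg R rho n 2 q (fun=> 1) n0 le1 even sr o0 T T0 tT.
  rewrite minxx mulr1 wick_const => lim.
  rewrite -(cvg_lim _ lim) //; apply: limr_ge; first by apply: cvgP lim.
  near=> k.
  have k0 : (0 < k)%N by near: k; exact: nbhs_infty_gt.
  rewrite -lecR -(phi_Yproc W GG rho0 n (fun i => tT k i k0)) big_ord_recl.
  rewrite big_ord1; apply: (phi_ge0 W); exact: (star_Yproc W).
have -> : psi (\prod_(i < r) (c%:C *: X (t i))) =
   (wick (q ^+ (n ^ 2)) (fun a b => qfact q n * z * Num.min (t a) (t b)))%:C.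
  rewrite prod_scale_ord (phiZ WB) XB // -rmorphXn -rmorphM wick_scale.
  by rewrite /c sum_inv_count sqr_sqrtr.
have [T [T0 tT]] := npts_uniform_bound t0.
have /cvgrPdist_lt lim := @blockfock_cvg R rho n r q t n0 le1 even sr t0 T T0 tT.
move=> e /lim[N _ hN]; exists (maxn N 1) => k; rewrite geq_max => /andP[Nk k0].
rewrite (phi_Yproc W GG rho0 n (fun i => tT k i k0)) -rmorphB.
have := hN k Nk; rewrite distrC => h.
by rewrite normc_def /= expr0n addr0 sqrtr_sqr ltcR.
Unshelve. all: by end_near. Qed.
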